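(* Let $\mathcal{B}$, $\mathbb{P}$, $q$ be as in the context, let $\mathbf{z}=(\mathbf{z}_1,\ldots,\mathbf{z}_q)\in\mathcal{B}^q$, let $S=\{\mathbf{z}_i\}_{1\le i\le q}$, and partition $S$ into $S_\partial=S\cap\partial\mathcal{B}$ and $S_\circ=S\cap\mathcal{B}^\circ$. Then $\mathbf{z}$ is a vertex of the inside-out polytope $(\mathcal{B}^q,\mathcal{A}_{\mathbb{P}}^q)$ if and only if (1) $S_\partial$ can be written as the union of (the point sets of) corner trajectories and rigid cycles, and (2) every point of $S_\circ$ is a crossing point of augmentations of these corner trajectories and rigid cycles (self-crossing points allowed).
   Context: Board: $\mathcal{B}\subset\mathbb{R}^2$ is a convex polygon with rational corner coordinates, interior $\mathcal{B}^\circ$, boundary $\partial\mathcal{B}$; each side lies on a line $\alpha_1x+\alpha_2y=\beta$. Piece: $\mathbb{P}$ is a two-move rider with nonparallel basic moves $\mathbf{m}_1=(c_1,d_1)$, $\mathbf{m}_2=(c_2,d_2)$, each with relatively prime integer coordinates. For $\mathbf{z}=(\mathbf{z}_1,\dots,\mathbf{z}_q)\in(\mathbb{R}^2)^q=\mathbb{R}^{2q}$, the attack equation of type $r$ between $i\neq j$ is the hyperplane $(\mathbf{z}_i-\mathbf{z}_j)\cdot(d_r,-c_r)=0$, written $\mathbf{z}_i\sim_r\mathbf{z}_j$; $\mathcal{A}_{\mathbb{P}}^q$ is the arrangement of all of them. A fixation is a hyperplane $(\alpha_1,\alpha_2)\cdot\mathbf{z}_i=\beta$ where $\alpha_1x+\alpha_2y=\beta$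 is the line of a side of $\mathcal{B}$. A vertex of the inside-out polytope $(\mathcal{B}^q,\mathcal{A}_{\mathbb{P}}^q)$ is a point of $\mathcal{B}^q$ that is the unique common point of some collection of attack equations and fixations. For a point $\mathbf{z}$, $\mathcal{H}(\mathbf{z})$ is the set of all attack equations and fixations containing $\mathbf{z}$; the rank of $\mathbf{z}\in\mathbb{R}^{2q}$ is the rank of the linear system $\mathcal{H}(\mathbf{z})$, and $\mathbf{z}$ has full rank if this rank is $2q$. The rank of a finite set $\{\mathbf{p}_1,\dots,\mathbf{p}_k\}$ of distinct points of $\mathbb{R}^2$ is the rank of $(\mathbf{p}_1,\dots,\mathbf{p}_k)\in\mathbb{R}^{2k}$. Dynamics: for $r\in\{1,2\}$ the antipode map $s_r:\partial\mathcal{B}\to\partial\mathcal{B}$ sends $\mathbf{b}$ to itself if the line $\ell=\{\mathbf{b}+\lambda\mathbf{m}_r:\lambda\in\mathbb{R}\}$ misses $\mathcal{B}^\circ$, and otherwise to the other point of $\ell\cap\partial\mathcal{B}$ (which has exactly two points). An extended trajectory is a sequence $(\mathbf{b}_i)_{i\in I}$ of points of $\partial\mathcal{B}$, $I\subseteq\mathbb{Z}$ an interval (possibly infinite in either direction), with $\mathbf{b}_{i+1}=s_{r_i}(\mathbf{b}_i)\neq\mathbf{b}_i$ where $r_i\in\{1,2\}$ alternates ($r_{i+1}\neq r_i$), which is maximal (cannot be extended at either end under these rules). A trajectory is a finite consecutive subsequence $[\mathbf{b}_1,\dots,\mathbf{b}_l]$ of distinct points of an extended trajectory; $l$ is its length,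 and its rank is the rank of its point set. A cyclical trajectory is a trajectory $[\mathbf{b}_1,\ldots,\mathbf{b}_p]$ of $p$ consecutive points of an extended trajectory that is periodic with minimal period $p\ge2$ (so the next point after $\mathbf{b}_p$ is $\mathbf{b}_1$). A rigid cycle is a cyclical trajectory of full rank. A corner trajectory is a trajectory containing a corner of $\mathcal{B}$. The augmentation of a trajectory $[\mathbf{b}_1,\ldots,\mathbf{b}_l]$ is the sequence obtained by prepending the point $\mathbf{b}_0$ preceding $\mathbf{b}_1$ in its extended trajectory (if it exists) and appending the point $\mathbf{b}_{l+1}$ following $\mathbf{b}_l$ (if it exists). For two such sequences $[\mathbf{a}_1,\ldots,\mathbf{a}_k]$, $[\mathbf{b}_1,\ldots,\mathbf{b}_l]$, a crossing point is a point $\mathbf{c}\in\mathcal{B}^\circ$ lying on both a segment $[\mathbf{a}_i,\mathbf{a}_{i+1}]$ and a segment $[\mathbf{b}_j,\mathbf{b}_{j+1}]$; if the two sequences coincide it is a self-crossing point.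
   Formalization: A crossing point (or self-crossing point) is required to lie on two distinct segments; if the same segment could be used twice, every interior point of one segment would count as a self-crossing point and the ''if'' direction would fail. *)

(* Defs.v *)
From HB Require Import structures.
From mathcomp Require Import all_boot all_order all_algebra.
From mathcomp Require Import all_classical all_reals all_analysis.

Set Implicit Arguments.
Unset Strict Implicit.
Unset Printing Implicit Defensive.

Import Order.TTheory GRing.Theory Num.Theory.
Import numFieldNormedType.Exports.

Local Open Scope classical_set_scope.
Local Open Scope ring_scope.

(* Points of the plane are row vectors 'rV[R]_2, and a configuration of q     *)
(* points (an element of R^(2q)) is a q x 2 matrix whose i-th row is z_i.     *)

Definition vec2 (R : realType) (x y : R) : 'rV[R]_2 :=
  \row_(j < 2) if j == 0 then x else y.

Definition dot (R : realType) (u v : 'rV[R]_2) : R :=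
  u 0 0 * v 0 0 + u 0 1 * v 0 1.

(* (c, d) |-> (d, -c) *)
Definition perp (R : realType) (u : 'rV[R]_2) : 'rV[R]_2 :=
  vec2 (u 0 1) (- u 0 0).

Definition segment (R : realType) (a b : 'rV[R]_2) : set 'rV[R]_2 :=
  [set p | exists2 t : R, 0 <= t <= 1 & p = (1 - t) *: a + t *: b].

(* The k-th side joins corner k to the cyclically next corner; its line is    *)
(* dot (side_normal c k) p = side_offset c k.                                 *)
Definition side_normal (R : realType) (n : nat) (c : 'I_n -> 'rV[R]_2)
  (k : 'I_n) : 'rV[R]_2 := perp (c (ordS k) - c k).

Definition side_offset (R : realType) (n : nat) (c : 'I_n -> 'rV[R]_2)
  (k : 'I_n) : R := dot (side_normal c k) (c k).

(* A convex polygon, given by its corners in counterclockwise order: all      *)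
(* corners other than the endpoints of a side lie strictly to the left of     *)
(* that side. This forces the corners to be distinct and in convex position.  *)
Record board (R : realType) := Board {
  ncorners : nat;
  corner : 'I_ncorners -> 'rV[R]_2;
  ncorners_ge3 : (3 <= ncorners)%N;
  corner_rational : forall i j, exists a : rat, corner i 0 j = ratr a;
  corner_convex : forall k j, j != k -> j != ordS k ->
    dot (side_normal corner k) (corner j) < side_offset corner k
}.

Definition region (R : realType) (B : board R) : set 'rV[R]_2 :=
  [set p | exists l : 'I_(ncorners B) -> R,
    [/\ forall i, 0 <= l i, \sum_i l i = 1 & p = \sum_i l i *: corner i]].

Definition inside (R : realType) (B : board R) : set 'rV[R]_2 :=
  interior (region B).

Definition boundary (R : realType) (B : board R) : set 'rV[R]_2 :=
  closure (region B) `\` interior (region B).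

(* The two move types r = 1, 2 are indexed by false and true.                 *)
Record two_move_rider := TwoMoveRider {
  basic_move : bool -> int * int;
  basic_move_coprime : forall r, coprimez (basic_move r).1 (basic_move r).2;
  basic_move_nonparallel :
    (basic_move false).1 * (basic_move true).2 !=
    (basic_move true).1 * (basic_move false).2
}.

Definition movevec (R : realType) (P : two_move_rider) (r : bool) : 'rV[R]_2 :=
  vec2 ((basic_move P r).1%:~R) ((basic_move P r).2%:~R).

(* Index type for the equations on configurations of q points:                *)
(* inl (r, i, j) is the attack equation z_i ~_r z_j (meaningful for i != j),  *)
(* inr (k, i) is the fixation of z_i to the line of the k-th side.            *)
Definition equation (R : realType) (B : board R) (q : nat) : finType :=
  ((bool * 'I_q * 'I_q) + ('I_(ncorners B) * 'I_q))%type.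

Definition eqns (R : realType) (B : board R) (q : nat) : {set equation B q} :=
  [set e : equation B q | if e is inl (_, i, j) then i != j else true]%SET.

Definition eqn_lhs (R : realType) (B : board R) (P : two_move_rider) (q : nat)
    (e : equation B q) (z : 'M[R]_(q, 2)) : R :=
  match e with
  | inl (r, i, j) => dot (row i z - row j z) (perp (movevec R P r))
  | inr (k, i) => dot (side_normal (@corner R B) k) (row i z)
  end.

Definition eqn_rhs (R : realType) (B : board R) (q : nat) (e : equation B q) : R :=
  match e with
  | inl _ => 0
  | inr (k, _) => side_offset (@corner R B) k
  end.

Definition eqn_holds (R : realType) (B : board R) (P : two_move_rider)
    (q : nat) (e : equation B q) (z : 'M[R]_(q, 2)) : bool :=
  eqn_lhs P e z == eqn_rhs e.

Definition eqn_coef (R : realType) (B : board R) (P : two_move_rider) (q : nat)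
    (e : equation B q) : 'M[R]_(q, 2) :=
  \matrix_(i, j) eqn_lhs P e (delta_mx i j).

Definition eqns_at (R : realType) (B : board R) (P : two_move_rider) (q : nat)
    (z : 'M[R]_(q, 2)) : {set equation B q} :=
  [set e in eqns B q | eqn_holds P e z]%SET.

Definition config_rank (R : realType) (B : board R) (P : two_move_rider)
    (q : nat) (z : 'M[R]_(q, 2)) : nat :=
  \rank (\matrix_(k < #|eqns_at B P z|) mxvec (eqn_coef P (enum_val k))).

Definition full_rank (R : realType) (B : board R) (P : two_move_rider)
    (q : nat) (z : 'M[R]_(q, 2)) : Prop := config_rank B P z = (2 * q)%N.

Definition is_vertex (R : realType) (B : board R) (P : two_move_rider)
    (q : nat) (z : 'M[R]_(q, 2)) : Prop :=
  (forall i, region B (row i z)) /\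
  exists2 C : {set equation B q}, C \subset eqns B q &
    forall w : 'M[R]_(q, 2), (forall e, e \in C -> eqn_holds P e w) <-> w = z.

Definition move_line (R : realType) (P : two_move_rider) (r : bool)
    (b : 'rV[R]_2) : set 'rV[R]_2 :=
  [set p | exists t : R, p = b + t *: movevec R P r].

Definition antipode (R : realType) (B : board R) (P : two_move_rider)
    (r : bool) (b : 'rV[R]_2) : 'rV[R]_2 :=
  if `[< move_line P r b `&` inside B = set0 >] then b
  else xget b [set p | (move_line P r b `&` boundary B) p /\ p <> b].

(* The values of b outside I are irrelevant.                                  *)
Definition alternating (R : realType) (B : board R) (P : two_move_rider)
    (I : interval int) (b : int -> 'rV[R]_2) : Prop :=
  (forall i, i \in I -> boundary B (b i)) /\
  exists r : int -> bool,
    (forall i, i \in I -> i + 1 \in I ->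
       b (i + 1) = antipode B P (r i) (b i) /\ b (i + 1) <> b i) /\
    (forall i, i \in I -> i + 1 \in I -> i + 2 \in I -> r (i + 1) != r i).

Definition extended_trajectory (R : realType) (B : board R)
    (P : two_move_rider) (I : interval int) (b : int -> 'rV[R]_2) : Prop :=
  alternating B P I b /\
  forall (I' : interval int) (b' : int -> 'rV[R]_2), alternating B P I' b' ->
    {subset I <= I'} -> {in I, b' =1 b} -> I' =i I.

Definition trajectory_at (R : realType) (B : board R) (P : two_move_rider)
    (I : interval int) (b : int -> 'rV[R]_2) (m : int)
    (t : seq 'rV[R]_2) : Prop :=
  [/\ extended_trajectory B P I b,
      (0 < size t)%N,
      forall i : nat, (i < size t)%N -> m + i%:Z \in I,
      t = mkseq (fun i => b (m + i%:Z)) (size t) &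
      uniq t].

Definition trajectory (R : realType) (B : board R) (P : two_move_rider)
    (t : seq 'rV[R]_2) : Prop :=
  exists I b m, trajectory_at B P I b m t.

Definition corner_trajectory (R : realType) (B : board R) (P : two_move_rider)
    (t : seq 'rV[R]_2) : Prop :=
  trajectory B P t /\ exists i : 'I_(ncorners B), corner i \in t.

Definition has_period (T : Type) (b : int -> T) (p : nat) : Prop :=
  forall i, b (i + p%:Z) = b i.

Definition cyclical_trajectory (R : realType) (B : board R)
    (P : two_move_rider) (t : seq 'rV[R]_2) : Prop :=
  exists I b m,
    [/\ trajectory_at B P I b m t,
        forall i, i \in I,
        (2 <= size t)%N,
        has_period b (size t) &
        forall p, (0 < p < size t)%N -> ~ has_period b p].

Definition rigid_cycle (R : realType) (B : board R) (P : two_move_rider)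
    (t : seq 'rV[R]_2) : Prop :=
  cyclical_trajectory B P t /\ full_rank B P (\matrix_(i < size t) t`_i).

(* The augmentation of t is unique up to the orientation of the extended      *)
(* trajectory in which t occurs (when t has length 1).                        *)
Definition augmentation (R : realType) (B : board R) (P : two_move_rider)
    (t u : seq 'rV[R]_2) : Prop :=
  exists I b m, trajectory_at B P I b m t /\
    u = (if m - 1 \in I then [:: b (m - 1)] else [::]) ++ t ++
        (if m + (size t)%:Z \in I then [:: b (m + (size t)%:Z)] else [::]).

(* The two segments must be distinct: otherwise every interior point of a     *)
(* single segment would be a self-crossing point.                             *)
Definition crossing_point (R : realType) (B : board R)
    (u v : seq 'rV[R]_2) (c : 'rV[R]_2) : Prop :=
  inside B c /\
  exists i j : nat,
    [/\ (i.+1 < size u)%N, (j.+1 < size v)%N,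
        segment u`_i u`_i.+1 c, segment v`_j v`_j.+1 c &
        segment u`_i u`_i.+1 <> segment v`_j v`_j.+1].

(* Main.v *)
Require Import Defs.
From HB Require Import structures.
From mathcomp Require Import all_boot all_order all_algebra.
From mathcomp Require Import all_classical all_reals all_analysis.
From mathcomp Require Import ring lra zify.
Import Order.TTheory GRing.Theory Num.Theory.
Import numFieldNormedType.Exports.
Local Open Scope classical_set_scope.
Local Open Scope ring_scope.

Set Implicit Arguments.
Unset Strict Implicit.
Unset Printing Implicit Defensive.

(* The two linear forms that are constant along the moves are coordinates of the
   plane, so a configuration is a choice of values for the move lines through its
   points: attack equations say that points share a line, an interior point
   imposes nothing, a boundary point relates the values of its two lines, and a
   corner fixes both. A chord has just two boundary points, so the lines and the
   boundary points form paths and cycles, which are the trajectories. Fixedness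
   spreads from a corner along its trajectory, and a rigid cycle fixes itself.
   Conversely, from a boundary point of a vertex follow the trajectory both ways
   inside the configuration: if it meets no corner and is not a cycle, its points
   can slide along their sides, contradicting rigidity; if it is a cycle, any
   infinitesimal motion of it extends by zero to the whole configuration, so it
   has full rank. An interior point is fixed only if both its lines carry fixed
   boundary points. *)

(** * Geometry of the board *)

Section Plane.
Variable R : realType.
Implicit Types p q u v m : 'rV[R]_2.

Lemma rV2P p q : p 0 0 = q 0 0 -> p 0 1 = q 0 1 -> p = q.
Proof.
move=> e0 e1; apply/rowP => -[[|[|//]] lt_i].
  by rewrite (_ : Ordinal lt_i = 0) //; apply: val_inj.
by rewrite (_ : Ordinal lt_i = 1) //; apply: val_inj.
Qed.

Lemma vec2_0 (x y : R) : vec2 x y 0 0 = x.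
Proof. by rewrite mxE. Qed.

Lemma vec2_1 (x y : R) : vec2 x y 0 1 = y.
Proof. by rewrite mxE. Qed.

Lemma dotE u v : dot u v = u 0 0 * v 0 0 + u 0 1 * v 0 1.
Proof. by []. Qed.

Lemma dotC u v : dot u v = dot v u.
Proof. by rewrite !dotE; ring. Qed.

Lemma dotDr u p q : dot u (p + q) = dot u p + dot u q.
Proof. by rewrite !dotE !mxE; ring. Qed.

Lemma dotBr u p q : dot u (p - q) = dot u p - dot u q.
Proof. by rewrite !dotE !mxE; ring. Qed.

Lemma dotZr u (a : R) p : dot u (a *: p) = a * dot u p.
Proof. by rewrite !dotE !mxE; ring. Qed.

Lemma dot0r u : dot u 0 = 0.
Proof. by rewrite !dotE !mxE; ring. Qed.

Lemma dotDl u p q : dot (p + q) u = dot p u + dot q u.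
Proof. by rewrite !(dotC _ u) dotDr. Qed.

Lemma dotBl u p q : dot (p - q) u = dot p u - dot q u.
Proof. by rewrite !(dotC _ u) dotBr. Qed.

Lemma dotZl u (a : R) p : dot (a *: p) u = a * dot p u.
Proof. by rewrite !(dotC _ u) dotZr. Qed.

Lemma dot0l u : dot 0 u = 0.
Proof. by rewrite dotC dot0r. Qed.

Lemma dot_sumr (I : finType) u (F : I -> 'rV[R]_2) :
  dot u (\sum_i F i) = \sum_i dot u (F i).
Proof.
apply: (big_ind2 (fun p x => dot u p = x)) => //; first exact: dot0r.
by move=> p x q y <- <-; rewrite dotDr.
Qed.

Lemma dot_perpC u v : dot u (perp v) = - dot (perp u) v.
Proof. by rewrite !dotE !vec2_0 !vec2_1; ring. Qed.

Lemma dot_perp u : dot u (perp u) = 0.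
Proof. by rewrite !dotE !vec2_0 !vec2_1; ring. Qed.

Lemma dot_self_eq0 u : dot u u = 0 -> u = 0.
Proof.
move=> /eqP; rewrite dotE -!expr2 paddr_eq0 ?sqr_ge0 // !sqrf_eq0.
by move=> /andP[/eqP e0 /eqP e1]; apply: rV2P; rewrite ?e0 ?e1 mxE.
Qed.

Lemma perp_eq0 u : perp u = 0 -> u = 0.
Proof.
move=> e; apply: dot_self_eq0.
have -> : dot u u = dot (perp u) (perp u) by rewrite !dotE !(vec2_0, vec2_1); ring.
by rewrite e dot0r.
Qed.

Lemma perpK u : perp (perp u) = - u.
Proof. by apply: rV2P; rewrite !(vec2_0, vec2_1) mxE. Qed.

(** Cramer's rule: [dot a (perp b)] is the determinant of [a] and [b]. *)
Lemma dot_eq0_indep (a b v : 'rV[R]_2) :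
  dot a (perp b) != 0 -> dot a v = 0 -> dot b v = 0 -> v = 0.
Proof.
move=> ab av bv.
have e0 : dot a (perp b) * v 0 0 = 0.
  have -> : dot a (perp b) * v 0 0 = b 0 1 * dot a v * 1 - a 0 1 * dot b v
    by rewrite !dotE !vec2_0 !vec2_1; ring.
  by rewrite av bv; ring.
have e1 : dot a (perp b) * v 0 1 = 0.
  have -> : dot a (perp b) * v 0 1 = - b 0 0 * dot a v + a 0 0 * dot b v
    by rewrite !dotE !vec2_0 !vec2_1; ring.
  by rewrite av bv; ring.
apply: rV2P; rewrite [RHS]mxE.
  by move/eqP: e0; rewrite mulf_eq0 (negbTE ab) => /eqP.
by move/eqP: e1; rewrite mulf_eq0 (negbTE ab) => /eqP.
Qed.

Lemma dot_perp_eq0_collinear m p :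
  m != 0 -> dot p (perp m) = 0 -> exists t : R, p = t *: m.
Proof.
move=> m0 pm; have mm : dot m m != 0.
  by apply: contra_neq m0; apply: dot_self_eq0.
have e : p 0 0 * m 0 1 = p 0 1 * m 0 0.
  by move: pm; rewrite dotE vec2_0 vec2_1 => pm; lra.
exists (dot p m / dot m m); apply: rV2P; rewrite mxE.
  apply: (mulIf mm); rewrite mulrAC divfK // !dotE.
  transitivity (m 0 0 * (p 0 0 * m 0 0) + m 0 1 * (p 0 0 * m 0 1)); first ring.
  by rewrite e; ring.
apply: (mulIf mm); rewrite mulrAC divfK // !dotE.
transitivity (m 0 0 * (p 0 1 * m 0 0) + m 0 1 * (p 0 1 * m 0 1)); first ring.
by rewrite -e; ring.
Qed.

Lemma dot_cvg u p : dot u q @[q --> p] --> dot u p.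
Proof.
have F : Filter (nbhs p) by exact: nbhs_filter.
have h j : u 0 j * q 0 j @[q --> p] --> u 0 j * p 0 j.
  apply: (@cvgM _ _ (nbhs p) F (cst (u 0 j)) (fun q : 'rV[R]_2 => q 0 j)).
    exact: cvg_cst.
  exact: coord_continuous.
exact: (cvgD (h 0) (h 1)).
Qed.

Lemma segmentC p q : segment p q = segment q p.
Proof.
apply/seteqP; split=> x [t t01 ->]; exists (1 - t); first lra.
- by rewrite opprB addrCA subrr addr0 addrC.
- lra.
- by rewrite opprB addrCA subrr addr0 addrC.
Qed.

Lemma segment_dot p q x u (a : R) :
  segment p q x -> dot p u = a -> dot q u = a -> dot x u = a.
Proof. by move=> [t _ ->] pa qa; rewrite dotDl !dotZl pa qa; ring. Qed.

Lemma segment_left p q : segment p q p.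
Proof. by exists 0; [lra | rewrite subr0 scale1r scale0r addr0]. Qed.

End Plane.

(** Each inequality holds on a whole interval of small positive steps, and finitely many such
    intervals have a common point. The induction therefore carries all steps up to [t], so that [t]
    can be shrunk. *)
Lemma exists_small_step (R : realType) (I : finType) (a b : I -> R) :
  (forall i, a i < 0 \/ a i <= 0 /\ b i < 0) ->
  exists2 t : R, 0 < t & forall i, a i + t * b i < 0.
Proof.
move=> ab.
suff [t t0 Ht] : exists2 t : R, 0 < t &
    forall s, 0 < s <= t -> forall i, i \in enum I -> a i + s * b i < 0.
  by exists t => // i; apply: Ht; rewrite ?mem_enum // t0 lexx.
elim: (enum I) => [|j s [t t0 Ht]]; first by exists 1.
have [e e0 He] : exists2 e : R, 0 < e & forall s, 0 < s <= e -> a j + s * b j < 0.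
  have [bj|bj] := ltP (b j) 0.
    exists 1 => // s' /andP[s0 _].
    have aj : a j <= 0 by case: (ab j) => [/ltW|[]].
    by rewrite (lt_le_trans (y := a j)) // gtrDl pmulr_rlt0.
  have aj : a j < 0 by case: (ab j) => [//|[_]]; rewrite ltNge bj.
  (* The summand 1 keeps the denominator positive when [b j = 0] and makes the bound strict:
     [a j + s * b j <= - s]. *)
  exists (- a j / (b j + 1)); first by rewrite divr_gt0 //; lra.
  move=> s' /andP[s0]; rewrite ler_pdivlMr; last lra.
  by move=> ?; nra.
exists (Num.min e t); first by rewrite lt_min e0 t0.
move=> s' /andP[s0]; rewrite le_min => /andP[se st] i.
by rewrite in_cons => /predU1P[->|]; [apply: He|apply: Ht]; rewrite ?s0.
Qed.

(** * The polygon as an intersection of half-planes *)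

Section Polygon.
Variables (R : realType) (B : board R).
Implicit Types (p q : 'rV[R]_2) (k j : 'I_(ncorners B)).

Local Notation c := (@corner R B).
Local Notation n := (side_normal c).
Local Notation o := (side_offset c).

Lemma normal_corner k : dot (n k) (c k) = o k.
Proof. by []. Qed.

Lemma normal_cornerS k : dot (n k) (c (ordS k)) = o k.
Proof.
apply/eqP; rewrite -subr_eq0 -dotBr dotC; apply/eqP; exact: dot_perp.
Qed.

Lemma normal_corner_le k j : dot (n k) (c j) <= o k.
Proof.
have [->|jk] := eqVneq j k; first by rewrite normal_corner.
have [->|jk'] := eqVneq j (ordS k); first by rewrite normal_cornerS.
exact/ltW/corner_convex.
Qed.

Lemma val_ordS k : ordS k = (if k.+1 == ncorners B then 0 else k.+1) :> nat.
Proof.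
have N3 := ncorners_ge3 B; have kN := ltn_ord k.
rewrite /=; case: eqVneq => [->|kN']; first by rewrite modnn.
by rewrite modn_small // ltn_neqAle kN' kN.
Qed.

Lemma ordS_neq k : ordS k != k.
Proof.
have N3 := ncorners_ge3 B; have kN := ltn_ord k.
apply/negP => /eqP/(congr1 (@nat_of_ord _)); rewrite val_ordS.
by case: eqVneq => ? ?; lia.
Qed.

Lemma ordSS_neq k : ordS (ordS k) != k.
Proof.
have N3 := ncorners_ge3 B; have kN := ltn_ord k.
apply/negP => /eqP/(congr1 (@nat_of_ord _)); rewrite val_ordS val_ordS.
by case: (eqVneq k.+1) => ?; case: eqVneq => ? ?; lia.
Qed.

Lemma normal_cornerSS k : dot (n k) (c (ordS (ordS k))) < o k.
Proof. by apply: corner_convex; [exact: ordSS_neq | exact: ordS_neq]. Qed.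

(** Up to sign, this determinant measures how far the corner two steps after [k] lies inside side
    [k], which is positive by strict convexity. *)
Lemma adjacent_normals_indep k : dot (n k) (perp (n (ordS k))) != 0.
Proof.
have := normal_cornerSS k; rewrite -subr_lt0 -(normal_cornerS k) -dotBr.
set d := c _ - _ => lt0; rewrite /side_normal -/d.
suff -> : dot (n k) (perp (perp d)) = - dot (n k) d by rewrite oppr_eq0 lt_eqF.
by rewrite !dotE !vec2_0 !vec2_1 !vec2_0; ring.
Qed.

Lemma normal_neq0 k : n k != 0.
Proof.
by apply: contra_neq (adjacent_normals_indep k) => ->; rewrite dot0l.
Qed.

Lemma corner_fixed k v :
  (forall j, dot (n j) (c k) = o j -> dot (n j) v = 0) -> v = 0.
Proof.
have [k' ->] : exists k', k = ordS k' by exists (ord_pred k); rewrite ord_predK.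
move=> Hv; apply: dot_eq0_indep (adjacent_normals_indep k') _ _; apply: Hv.
  exact: normal_cornerS.
exact: normal_corner.
Qed.

Lemma region_le p k : region B p -> dot (n k) p <= o k.
Proof.
move=> [l [l0 l1 ->]]; rewrite dot_sumr -[leRHS]mul1r -l1 mulr_suml.
by apply: ler_sum => i _; rewrite dotZr ler_wpM2l // normal_corner_le.
Qed.

(** The weight function is a sum of three indicator terms, so coinciding indices need no separate
    treatment. *)
Lemma region_triangle (A A' A'' : R) i j k :
  0 <= A -> 0 <= A' -> 0 <= A'' -> A + A' + A'' = 1 ->
  region B (A *: c i + A' *: c j + A'' *: c k).
Proof.
move=> A0 A0' A0'' A1.
have sumE (V : lmodType R) (a : R) (F : 'I_(ncorners B) -> V) x :
    \sum_y (if y == x then a else 0) *: F y = a *: F x.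
  rewrite (bigD1 x) //= eqxx big1 ?addr0 // => y /negbTE ->.
  by rewrite scale0r.
exists (fun x => (if x == i then A else 0) + (if x == j then A' else 0)
  + (if x == k then A'' else 0)); split.
- by move=> x; rewrite !addr_ge0 //; case: ifP.
- by rewrite !big_split /= -!big_mkcond /= !big_pred1_eq.
- under eq_bigr do rewrite !scalerDl.
  by rewrite !big_split /= !sumE.
Qed.

(** Fan triangulation from corner 0: seen from there, [p] is to the left of the first diagonal
    direction and to the right of the last one, so some triangle of the fan contains it, at the
    first change of sign. *)
Lemma le_region p : (forall k, dot (n k) p <= o k) -> region B p.
Proof.
move=> Hp; have N3 := ncorners_ge3 B.
have N0 : (0 < ncorners B)%N by lia.
pose ci i := insubd (Ordinal N0) i : 'I_(ncorners B).
have ciE i : (i < ncorners B)%N -> ci i = i :> nat.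
  by move=> iN; rewrite val_insubd iN.
have ciS i : (i.+1 < ncorners B)%N -> ordS (ci i) = ci i.+1.
  move=> iN; apply: ord_inj.
  by rewrite val_ordS !ciE; try lia; case: eqVneq; lia.
have ciL i : (i.+1 = ncorners B)%N -> ordS (ci i) = ci 0%N.
  move=> iN; apply: ord_inj.
  by rewrite val_ordS !ciE; try lia; case: eqVneq; lia.
(* [orient a b x] is twice the signed area of the triangle [a], [b], [x]; ratios of such areas are
   the barycentric coordinates used at the end. *)
pose orient (a b x : 'rV[R]_2) := dot (perp (b - a)) (a - x).
have orientE k : orient (c k) (c (ordS k)) p = o k - dot (n k) p.
  by rewrite /orient dotBr.
pose g i := orient (c (ci 0%N)) (c (ci i)) p.
have g1 : 0 <= g 1%N by rewrite /g -ciS ?orientE ?subr_ge0 //; lia.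
have gL : g (ncorners B).-1 <= 0.
  have := Hp (ci (ncorners B).-1); rewrite -subr_ge0 -orientE ciL; last lia.
  by rewrite /g /orient !dotE !vec2_0 !vec2_1 !mxE => ?; lra.
have exj : exists j : nat, g j.+2 <= 0.
  exists (ncorners B - 3)%N; move: gL.
  by rewrite (_ : _.-1 = (ncorners B - 3).+2) //; lia.
case: (ex_minnP exj) => j gj minj.
have jN : (j <= ncorners B - 3)%N.
  apply: minj; move: gL.
  by rewrite (_ : _.-1 = (ncorners B - 3).+2) //; lia.
have gj1 : 0 <= g j.+1.
  case: j {gj jN} minj => [//|j] minj.
  by rewrite leNgt; apply/negP => /ltW /minj; rewrite ltnn.
have gs : 0 <= orient (c (ci j.+1)) (c (ci j.+2)) p.
  have jN2 : (j.+2 < ncorners B)%N by lia.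
  by rewrite -(ciS _ jN2) orientE subr_ge0.
pose D := orient (c (ci j.+1)) (c (ci j.+2)) (c (ci 0%N)).
have D0 : 0 < D.
  rewrite /D /orient -ciS; last lia.
  rewrite dotBr subr_gt0; apply: corner_convex.
    by rewrite -val_eqE /= !ciE; lia.
  by rewrite ciS -?val_eqE /= ?ciE; lia.
have Dn0 : D != 0 by rewrite gt_eqF.
have -> : p = (orient (c (ci j.+1)) (c (ci j.+2)) p / D) *: c (ci 0%N)
    + (- g j.+2 / D) *: c (ci j.+1) + (g j.+1 / D) *: c (ci j.+2).
  move: Dn0; rewrite /D /g /orient.
  by move=> Dn0; apply: rV2P; move: Dn0; rewrite !mxE !dotE !vec2_0 !vec2_1 !mxE
    => Dn0; field.
apply: region_triangle; rewrite ?divr_ge0 ?(ltW D0) //; first by rewrite oppr_ge0.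
rewrite -!mulrDl; apply: (mulIf Dn0); rewrite divfK // mul1r.
by rewrite /D /g /orient !dotE !vec2_0 !vec2_1 !mxE; ring.
Qed.

(** A point on a side leaves the region under any small push along the outer normal; conversely,
    finitely many strict inequalities define an open set. *)
Lemma insideP p : inside B p <-> forall k, dot (n k) p < o k.
Proof.
split=> [Ip k|Ip].
  have pR : region B p by exact: nbhs_singleton.
  rewrite lt_neqAle region_le // andbT; apply/negP => /eqP e.
  have cvg : (fun t : R => p + t *: n k) t @[t --> 0] --> p.
    suff : (fun t : R => p + t *: n k) t @[t --> 0] --> p + (0 : R) *: n k.
      by rewrite scale0r addr0.
    apply: (@cvgD _ _ _ _ _ (cst p) (fun t : R => t *: n k)).
      exact: cvg_cst.
    by apply: cvgZr_tmp; exact: cvg_id.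
  have := cvg _ Ip; rewrite /= nbhs_simpl => /nbhs_ballP [e' /= e'0 He].
  have e2 : ball (0 : R) e' (e' / 2).
    by rewrite /ball /= sub0r normrN ger0_norm; lra.
  have := region_le k (He _ e2); rewrite dotDr e dotZr gerDl.
  rewrite pmulr_rle0; last by rewrite divr_gt0.
  have : 0 <= dot (n k) (n k) by rewrite dotE -!expr2 addr_ge0 ?sqr_ge0.
  move=> ge0 le0; have : dot (n k) (n k) = 0 by apply/le_anti/andP.
  by move/dot_self_eq0/eqP; apply/negP/normal_neq0.
have : \forall x \near p, forall k, dot (n k) x < o k.
  have F : Filter (nbhs p) by exact: nbhs_filter.
  apply: (@filter_forall _ _ (fun k x => dot (n k) x < o k) (nbhs p) F) => k.
  exact: (cvgr_lt (dot (n k) p) (@dot_cvg _ (n k) p)).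
by apply: filterS => x Hx; apply: le_region => k; exact/ltW.
Qed.

Lemma boundaryP p :
  boundary B p <-> region B p /\ exists k, dot (n k) p = o k.
Proof.
split=> [[clp nip]|[Rp [k e]]]; last first.
  split; first exact: subset_closure.
  by move=> /insideP/(_ k); rewrite e ltxx.
have Rp : region B p.
  apply: le_region => k; rewrite leNgt; apply/negP => lt.
  have : \forall x \near p, o k < dot (n k) x.
    exact: (cvgr_gt (dot (n k) p) (@dot_cvg _ (n k) p)).
  move=> /clp [x [Rx /=]]; rewrite ltNge; apply/negP; rewrite negbK.
  exact: region_le.
split => //; apply: contrapT => noside; apply: nip; apply/insideP => k.
by rewrite lt_neqAle region_le // andbT; apply/eqP => e; apply: noside; exists k.
Qed.

Lemma boundary_region p : boundary B p -> region B p.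
Proof. by case/boundaryP. Qed.

Lemma boundary_inside p : boundary B p -> inside B p -> False.
Proof. by case. Qed.

Lemma region_boundary p k : region B p -> dot (n k) p = o k -> boundary B p.
Proof. by move=> ? ?; apply/boundaryP; split=> //; exists k. Qed.

Lemma region_inside_or_boundary p : region B p -> inside B p \/ boundary B p.
Proof.
move=> Rp; have [|ni] := pselect (inside B p); [by left | right].
by split=> //; apply: subset_closure.
Qed.

(** If [p] is on a side, its convex weights live on the two ends of that side. Two distinct sides
    share at most one corner, so a point on both would be that corner. *)
Lemma noncorner_side_unique p k j : region B p -> (forall i, p != c i) ->
  dot (n k) p = o k -> dot (n j) p = o j -> j = k.
Proof.
move=> [l [l0 l1 pE]] nc ek ej.
have sup i i' : dot (n i) p = o i -> l i' != 0 -> i' = i \/ i' = ordS i.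
  move=> ei li'; have [->|ne] := eqVneq i' i; first by left.
  have [->|ne'] := eqVneq i' (ordS i); first by right.
  exfalso; move: ei; rewrite pE dot_sumr => /eqP; rewrite lt_eqF //.
  rewrite -[ltRHS]mul1r -l1 mulr_suml.
  rewrite (bigD1 i') //= [ltRHS](bigD1 i') //=; apply: ltr_leD.
    rewrite dotZr ltr_pM2l ?corner_convex //.
    by rewrite lt_neqAle eq_sym li' l0.
  by apply: ler_sum => x _; rewrite dotZr ler_wpM2l // normal_corner_le.
apply/eqP; apply: contraT => jk.
have [i0 li0] : exists i, l i != 0.
  apply: contrapT => /forallNP l_eq0; move: l1; rewrite big1 => [/eqP|i _].
    by rewrite eq_sym oner_eq0.
  by apply/eqP/negPn/negP.
have only i : l i != 0 -> i = i0.
  move=> li; apply: contrapT => ii0.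
  have /eqP jk' := jk; have /eqP k2 := ordSS_neq k; have /eqP j2 := ordSS_neq j.
  by case: (sup k i ek li) (sup k i0 ek li0) (sup j i ej li) (sup j i0 ej li0)
    => [] e0 [] e1 [] e2 [] e3; congruence.
have p_i0 : p = l i0 *: c i0.
  rewrite pE (bigD1 i0) //= big1 ?addr0 // => i ii0.
  have [->|/only e] := eqVneq (l i) 0; first by rewrite scale0r.
  by rewrite e eqxx in ii0.
have li01 : l i0 = 1.
  rewrite -l1 (bigD1 i0) //= big1 ?addr0 // => i ii0.
  have [->//|/only e] := eqVneq (l i) 0.
  by rewrite e eqxx in ii0.
by move: (nc i0); rewrite p_i0 li01 scale1r eqxx.
Qed.

Lemma noncorner_side_lt p k j : region B p -> (forall i, p != c i) ->
  dot (n k) p = o k -> j != k -> dot (n j) p < o j.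
Proof.
move=> Rp nc ek jk; rewrite lt_neqAle region_le // andbT.
by apply: contra_neq jk => /(noncorner_side_unique Rp nc ek).
Qed.

Lemma inside_between p q (s : R) : region B p -> inside B q -> 0 < s <= 1 ->
  inside B ((1 - s) *: p + s *: q).
Proof.
move=> Rp /insideP Iq s01; apply/insideP => k.
by rewrite dotDr !dotZr; have := Iq k; have := region_le k Rp; nra.
Qed.

Lemma sum_normals : \sum_k n k = 0.
Proof.
have E k : n k = perp (c (ordS k)) - perp (c k).
  by apply: rV2P; rewrite !mxE /=; ring.
rewrite (eq_bigr _ (fun k _ => E k)) sumrB.
by rewrite [X in _ - X](reindex _ (onW_bij _ (ordS_bij (ncorners B)))) subrr.
Qed.

(** The normals sum to zero, so if no product is positive then all vanish, which two independent
    normals forbid for [m != 0]. *)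
Lemma exists_side_ahead (m : 'rV[R]_2) : m != 0 -> exists k, 0 < dot (n k) m.
Proof.
move=> m0; apply: contrapT => /forallNP all_le.
have le0 k : dot (n k) m <= 0 by rewrite leNgt; apply/negP.
have sum0 : \sum_k dot (n k) m = 0.
  by under eq_bigr do rewrite dotC; rewrite -dot_sumr sum_normals dot0r.
have eq0 k : dot (n k) m = 0.
  apply/eqP; rewrite -oppr_eq0.
  have : \sum_k - dot (n k) m = 0 by rewrite sumrN sum0 oppr0.
  move=> /psumr_eq0P e; rewrite e // => i _; by rewrite oppr_ge0.
have N0 : (0 < ncorners B)%N by have := ncorners_ge3 B; lia.
by move: m0; rewrite
  (dot_eq0_indep (adjacent_normals_indep (Ordinal N0)) (eq0 _) (eq0 _)) eqxx.
Qed.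

End Polygon.

(** * Move lines, their chords and the antipode maps *)

Section Moves.
Variables (R : realType) (B : board R) (P : two_move_rider).
Implicit Types (p q b : 'rV[R]_2) (r : bool).

Local Notation m := (movevec R P).
Local Notation n := (side_normal (@corner R B)).
Local Notation o := (side_offset (@corner R B)).

(** The level sets are the move lines of type [r], so the attack equation of type [r] is equality of
    this coordinate. *)
Definition move_coord r p : R := dot p (perp (m r)).
Local Notation mu := move_coord.

Lemma move_coordB r p q : mu r (p - q) = mu r p - mu r q.
Proof. exact: dotBl. Qed.

Lemma move_coordD r p q : mu r (p + q) = mu r p + mu r q.
Proof. exact: dotDl. Qed.

Lemma move_coordZ r (a : R) p : mu r (a *: p) = a * mu r p.
Proof. exact: dotZl. Qed.

Lemma moves_indep r : dot (m r) (perp (m (~~ r))) != 0.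
Proof.
have h : dot (m false) (perp (m true)) != 0.
  rewrite dotE !vec2_0 !vec2_1 mulrN subr_eq0.
  have := basic_move_nonparallel P; apply: contra_neq => e.
  by apply: (@intr_inj R); rewrite !intrM e vec2_0 mulrC.
by case: r => //=; rewrite dot_perpC oppr_eq0 dotC.
Qed.

Lemma move_neq0 r : m r != 0.
Proof. by apply: contra_neq (moves_indep r) => ->; rewrite dot0l. Qed.

Lemma move_coord_eq0 v : (forall r, mu r v = 0) -> v = 0.
Proof.
move=> h; apply: (@dot_eq0_indep _ (perp (m true)) (perp (m false))).
- have := moves_indep true; rewrite !dotE !vec2_0 !vec2_1.
  by apply: contra_neq => e; rewrite -[RHS]e !vec2_0 !vec2_1; ring.
- by rewrite dotC; exact: h.
- by rewrite dotC; exact: h.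
Qed.

Lemma move_coord_inj p q : (forall r, mu r p = mu r q) -> p = q.
Proof.
move=> h; apply/eqP; rewrite -subr_eq0; apply/eqP/move_coord_eq0 => r.
by rewrite move_coordB h subrr.
Qed.

Lemma move_coord_inj2 r p q : mu r p = mu r q -> mu (~~ r) p = mu (~~ r) q -> p = q.
Proof. by move=> e1 e2; apply: move_coord_inj; case: r e1 e2 => ? ? []. Qed.

(** Each move vector has coordinate 0 for its own type, so it adjusts the other coordinate alone. *)
Lemma move_coord_surj (a : bool -> R) : exists v, forall r, mu r v = a r.
Proof.
exists ((a false / dot (m true) (perp (m false))) *: m true +
  (a true / dot (m false) (perp (m true))) *: m false) => r.
rewrite move_coordD !move_coordZ /move_coord.
by case: r; rewrite dot_perp mulr0 ?addr0 ?add0r divfK // (moves_indep true,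
  moves_indep false).
Qed.

Lemma move_coord_collinear r p q : mu r p = mu r q ->
  exists t : R, p = q + t *: m r.
Proof.
move=> e; have [|t et] := @dot_perp_eq0_collinear _ (m r) (p - q) (move_neq0 r).
  by rewrite dotBl; apply/eqP; rewrite subr_eq0; apply/eqP.
by exists t; rewrite -et addrC subrK.
Qed.

Lemma move_lineP r b p : move_line P r b p <-> mu r p = mu r b.
Proof.
split=> [[t ->]|/move_coord_collinear[t ->]]; last by exists t.
by rewrite move_coordD move_coordZ /move_coord dot_perp mulr0 addr0.
Qed.

Definition crosses r p := exists2 c, inside B c & mu r c = mu r p.

(** If [c] were beyond one of the two boundary points, that point would lie between the other one
    and the interior point [c], hence be interior itself. *)
Lemma chord_segment r b b' c : boundary B b -> boundary B b' -> b <> b' ->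
  mu r b = mu r b' -> inside B c -> mu r c = mu r b -> segment b b' c.
Proof.
move=> bd bd' bb' e Ic ec.
have [T eT] := move_coord_collinear (esym e).
have [t et] := move_coord_collinear ec.
have T0 : T != 0 by apply/eqP => T0; apply: bb'; rewrite eT T0 scale0r addr0.
have cE : c = (1 - t / T) *: b + (t / T) *: b'.
  by rewrite et eT scalerDr scalerA divfK // addrA -scalerDl subrK scale1r.
have [s0|s0] := ltP (t / T) 0.
  exfalso; apply: (boundary_inside bd).
  have -> : b = (1 - (1 - t / T)^-1) *: b' + (1 - t / T)^-1 *: c.
    have : 1 - t / T != 0 by rewrite gt_eqF //; lra.
    by rewrite cE; move: (t / T) => s hs; apply: rV2P; rewrite !mxE; field.
  apply: inside_between => //; first exact: boundary_region.
  by rewrite invr_gt0 invf_le1; lra.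
have [s1|s1] := ltP 1 (t / T); last by exists (t / T) => //; rewrite s0 s1.
exfalso; apply: (boundary_inside bd').
have -> : b' = (1 - (t / T)^-1) *: b + (t / T)^-1 *: c.
  have : t / T != 0 by rewrite gt_eqF //; lra.
  by rewrite cE; move: (t / T) => s hs; apply: rV2P; rewrite !mxE; field.
apply: inside_between => //; first exact: boundary_region.
by rewrite invr_gt0 invf_le1; lra.
Qed.

(** The interior point [c] separates [b] from both [x] and [y]. If these differed, the nearer one
    would lie between [c] and the farther one, and so be interior. *)
Lemma chord_end_unique r b x y : boundary B b -> boundary B x -> boundary B y ->
  crosses r b -> mu r x = mu r b -> mu r y = mu r b -> x <> b -> y <> b -> x = y.
Proof.
move=> bb bx by_ [c Ic ec] ex ey xb yb.
have neqc z : boundary B z -> c <> z.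
  by move=> bz e; apply: (boundary_inside bz); rewrite -e.
have [s s01 cx] := chord_segment bb bx (nesym xb) (esym ex) Ic ec.
have [s' s01' cy] := chord_segment bb by_ (nesym yb) (esym ey) Ic ec.
have {ex ey xb yb ec} key (z w : 'rV[R]_2) (u v : R) : boundary B z -> boundary B w ->
    0 <= u <= 1 -> 0 <= v <= 1 ->
    c = (1 - u) *: b + u *: z -> c = (1 - v) *: b + v *: w -> u < v -> False.
  move=> bz bw u01 v01 cz cw uv; apply: (boundary_inside bw).
  have u0 : 0 < u.
    rewrite lt_neqAle eq_sym; case/andP: u01 => -> _; rewrite andbT.
    apply/eqP => u0; apply: (neqc _ bb).
    by rewrite cz u0 subr0 scale1r scale0r addr0.
  (* Measured from [b] in units of [c - b], the points [c], [w], [z] are at 1, [1 / v] and [1 / u],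
     which yields the weight. *)
  have -> : w = (1 - (1 / u - 1 / v) / (1 / u - 1)) *: z
      + ((1 / u - 1 / v) / (1 / u - 1)) *: c.
    have u_n0 : u != 0 by rewrite gt_eqF.
    have v_n0 : v != 0 by rewrite gt_eqF //; lra.
    have u1_n0 : 1 - u != 0 by rewrite gt_eqF //; lra.
    have zE : z = b + u^-1 *: (c - b).
      by rewrite cz; apply: rV2P; rewrite !mxE; field.
    have wE : w = b + v^-1 *: (c - b).
      by rewrite cw; apply: rV2P; rewrite !mxE; field.
    by rewrite wE zE; apply: rV2P; rewrite !mxE; field;
      rewrite u_n0 v_n0 ?u1_n0 //=; lra.
  have v0 : 0 < v by lra.
  have iv : 1 <= 1 / v by rewrite div1r invf_ge1; lra.
  have iuv : 1 / v < 1 / u by rewrite !div1r ltf_pV2 // posrE.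
  apply: inside_between => //; first exact: boundary_region.
  rewrite divr_gt0 ?subr_gt0 //=; last lra.
  by rewrite ler_pdivrMr; lra.
have [ss'|ss'|ss'] := ltgtP s s'.
- by case: (key _ _ _ _ bx by_ s01 s01' cx cy ss').
- by case: (key _ _ _ _ by_ bx s01' s01 cy cx ss').
have s0 : s != 0.
  by apply/eqP => s0; apply: (neqc _ bb); rewrite cx s0 subr0 scale1r scale0r addr0.
move: cy; rewrite cx -ss' => /addrI /(congr1 (fun v => s^-1 *: v)).
by rewrite !scalerA mulVf // !scale1r.
Qed.

Lemma chord_end_exists r b : boundary B b -> crosses r b ->
  exists b', [/\ boundary B b', mu r b' = mu r b & b' <> b].
Proof.
move=> bb [c Ic ec]; pose w := c - b.
have w0 : w != 0.
  by rewrite subr_eq0; apply/eqP => e; apply: (boundary_inside bb); rewrite -e.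
have [k0 k0P] := exists_side_ahead B w0.
(* [F k] is the time at which the ray from [b] through [c] meets the line of side [k]; the first
   such time among the sides ahead gives the exit point. *)
pose F k := (o k - dot (n k) b) / dot (n k) w.
pose kk := [arg min_(k < k0 | 0 < dot (n k) w) F k]%O.
have [kkP kkmin] : 0 < dot (n kk) w /\ forall k, 0 < dot (n k) w -> F kk <= F k.
  by rewrite /kk; case: arg_minP.
have T0 : 0 < F kk.
  rewrite divr_gt0 // subr_gt0; move/insideP/(_ kk): Ic.
  by apply: le_lt_trans; move: kkP; rewrite dotBr subr_gt0 => /ltW.
exists (b + F kk *: w); split.
- apply: (@region_boundary _ _ _ kk); last first.
    by rewrite dotDr dotZr divfK ?gt_eqF // addrC subrK.
  apply: le_region => k; rewrite dotDr dotZr.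
  have [kP|kP] := ltP 0 (dot (n k) w).
    by rewrite -lerBrDl -ler_pdivlMr //; exact: kkmin.
  rewrite (le_trans _ (region_le k (boundary_region bb))) // gerDl.
  by rewrite pmulr_rle0.
- by rewrite move_coordD move_coordZ /w move_coordB ec subrr mulr0 addr0.
- move=> /eqP; rewrite -subr_eq0 addrC addKr scaler_eq0 gt_eqF //=.
  exact/negP.
Qed.

Lemma antipode_not_crosses r b : ~ crosses r b -> antipode B P r b = b.
Proof.
move=> nc; rewrite /antipode; case: asboolP => // /eqP/set0P[c [lc Ic]].
by case: nc; exists c => //; apply/move_lineP.
Qed.

Lemma antipode_crosses r b : boundary B b -> crosses r b ->
  [/\ boundary B (antipode B P r b), mu r (antipode B P r b) = mu r b
    & antipode B P r b <> b].
Proof.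
move=> bb cb; rewrite /antipode; case: asboolP => [e|_].
  by case: cb => c Ic ec; have : set0 c by rewrite -e; split=> //; apply/move_lineP.
have [b' [bb' eb' nb']] := chord_end_exists bb cb.
have : [set p | (move_line P r b `&` boundary B) p /\ p <> b] b'.
  by split=> //; split=> //; apply/move_lineP.
set A := [set p | _] => Ab'; have [[/move_lineP ? ?] ?] : A (xget b A).
  by apply: xgetPex; exists b'.
by split.
Qed.

Lemma antipode_boundary r b : boundary B b -> boundary B (antipode B P r b).
Proof.
move=> bb; have [cb|nc] := pselect (crosses r b).
  by have [] := antipode_crosses bb cb.
by rewrite antipode_not_crosses.
Qed.

Lemma antipode_coord r b : boundary B b -> mu r (antipode B P r b) = mu r b.
Proof.
move=> bb; have [cb|nc] := pselect (crosses r b).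
  by have [] := antipode_crosses bb cb.
by rewrite antipode_not_crosses.
Qed.

Lemma antipode_neq r b : antipode B P r b <> b -> crosses r b.
Proof. by move=> h; apply: contrapT => /antipode_not_crosses. Qed.

Lemma antipode_unique r b p : boundary B b -> boundary B p -> crosses r b ->
  mu r p = mu r b -> p <> b -> p = antipode B P r b.
Proof.
move=> bb bp cb ep pb; have [ba ea na] := antipode_crosses bb cb.
exact: (chord_end_unique bb bp ba cb ep ea pb na).
Qed.

Lemma crosses_coord r p q : mu r p = mu r q -> crosses r p -> crosses r q.
Proof. by move=> e [c Ic ec]; exists c => //; rewrite ec e. Qed.

Lemma antipodeK r b : boundary B b -> antipode B P r (antipode B P r b) = b.
Proof.
move=> bb; have [cb|nc] := pselect (crosses r b); last by rewrite !antipode_not_crosses.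
have [ba ea na] := antipode_crosses bb cb.
by apply/esym/antipode_unique => //; [apply: crosses_coord cb | exact: nesym].
Qed.

(** [perp (n k)] is a direction of the side, so the condition says that side and move are not
    parallel. Then a small step along the move, to the correct side, satisfies the single tight
    inequality strictly and preserves the others. This links the dynamics to motions: a line crosses
    the interior exactly when sliding along the side changes it. *)
Lemma noncorner_crosses r p k : boundary B p -> (forall i, p != @corner R B i) ->
  dot (n k) p = o k -> crosses r p <-> mu r (perp (n k)) != 0.
Proof.
move=> bp nc ek; have Rp := boundary_region bp.
have E : mu r (perp (n k)) = dot (n k) (m r).
  by rewrite /move_coord !dotE !vec2_0 !vec2_1 !vec2_0; ring.
rewrite E; split=> [[c /insideP/(_ k) Ic ec]|nm].
  have [t et] := move_coord_collinear ec.
  by apply/eqP => e; move: Ic; rewrite et dotDr dotZr e mulr0 addr0 ek ltxx.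
pose s : R := if 0 < dot (n k) (m r) then -1 else 1.
have sk : s * dot (n k) (m r) < 0.
  rewrite /s; case: (ltgtP 0 (dot (n k) (m r))) nm => [h _|h _|//].
    by rewrite mulN1r oppr_lt0.
  by rewrite mul1r.
have [j|t t0 tP] := @exists_small_step R _ (fun j => dot (n j) p - o j)
    (fun j => s * dot (n j) (m r)).
  have [->|jk] := eqVneq j k; first by right; rewrite ek subrr.
  by left; rewrite subr_lt0 (noncorner_side_lt Rp nc ek).
exists (p + (t * s) *: m r); last first.
  by rewrite move_coordD move_coordZ /move_coord dot_perp mulr0 addr0.
by apply/insideP => j; have := tP j; rewrite dotDr dotZr; lra.
Qed.

End Moves.

(** * Walks and trajectories *)

Lemma itv_int_convex (I : interval int) (a b x : int) :
  a \in I -> b \in I -> a <= x <= b -> x \in I.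
Proof.
case: I => l u; rewrite !itv_boundlr => /andP[la _] /andP[_ bu] /andP[ax xb].
by rewrite (le_trans la) ?(le_trans _ bu).
Qed.

Lemma PoszS (n : nat) : n.+1%:Z = n%:Z + 1.
Proof. by rewrite -addn1. Qed.

Lemma inj_le_of_lt (T : Type) (f : nat -> T) (m : nat) :
  (forall a b : nat, (b <= m)%N -> (a < b)%N -> f a = f b -> False) ->
  {in [pred i : nat | i <= m]%N &, injective f}.
Proof.
move=> wl a b; rewrite !inE => am bm /= e.
by case: (ltngtP a b) => // lt; [case: (wl a b) | case: (wl b a)].
Qed.

Section Walks.
Variables (R : realType) (B : board R) (P : two_move_rider).
Implicit Types (p q x y : 'rV[R]_2) (r : bool) (b f : int -> 'rV[R]_2) (i j : int).

Local Notation mu := (@move_coord R P).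
Local Notation s := (antipode B P).

Definition chord r x y :=
  [/\ boundary B x, boundary B y, x <> y, mu r x = mu r y & crosses B P r x].

Lemma chord_antipode r x y : chord r x y -> y = s r x.
Proof. by case=> bx by_ xy e cx; apply: antipode_unique => //; exact: nesym. Qed.

Lemma chordC r x y : chord r x y -> chord r y x.
Proof.
by case=> bx by_ xy e cx; split=> //; [exact: nesym | apply: crosses_coord cx].
Qed.

Lemma antipode_chord r x : boundary B x -> s r x <> x -> chord r x (s r x).
Proof.
move=> bx sx; split=> //; first exact: antipode_boundary.
- exact: nesym.
- by rewrite antipode_coord.
- exact: antipode_neq.
Qed.

Lemma chord_dir_unique r r' x y : chord r x y -> chord r' x y -> r = r'.
Proof.
move=> [_ _ xy e _] [_ _ _ e' _]; apply: contrapT => rr'; apply: xy.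
by apply: (@move_coord_inj2 _ P r) => //; case: r r' rr' e e' => -[].
Qed.

(* A bi-infinite sequence driven by the antipode maps alone: where an extended
   trajectory ends, the walk stands still for one step and then retraces it. *)
Definition walk f (d : int -> bool) :=
  [/\ forall i, boundary B (f i), forall i, f (i + 1) = s (d i) (f i) &
      forall i, d (i + 1) = ~~ d i].

Lemma walk_exists p r : boundary B p ->
  exists f d, [/\ walk f d, f 0 = p & d 0 = r].
Proof.
move=> bp; pose w r' := fix w n := if n is n'.+1 then s (r' (+) odd n') (w n') else p.
have bw r' n : boundary B (w r' n).
  by elim: n => //= n; exact: antipode_boundary.
(* [Negz n] is [- (n + 1)], reached by [n + 1] antipode steps that begin with the other move. *)
exists (fun i => match i with Posz n => w r n | Negz n => w (~~ r) n.+1 end).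
exists (fun i => r (+) odd `|i|%N); split; last by rewrite /= addbF.
- split=> [[n|n]|[n|n]|[n|n]]; try exact: bw.
  + by rewrite -PoszD addn1.
  + have -> : Negz n + 1 = - n%:Z by lia.
    rewrite /= (_ : r (+) ~~ odd n = ~~ r (+) odd n); last by rewrite addbN addNb.
    by rewrite antipodeK //; case: n.
  + by rewrite -PoszD absz_nat addn1 /= addbN.
  + rewrite NegzE (_ : - n.+1%:Z + 1 = - n%:Z); last by lia.
    by rewrite !abszN !absz_nat /= addbN negbK.
- by [].
Qed.

(** * Symmetries of a single walk and its maximal interval *)

Section OneWalk.
Variables (f : int -> 'rV[R]_2) (d : int -> bool).
Hypothesis fd : walk f d.

Lemma walk_boundary i : boundary B (f i).
Proof. by case: fd. Qed.

Lemma walkS i : f (i + 1) = s (d i) (f i).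
Proof. by case: fd. Qed.

Lemma walk_dirS i : d (i + 1) = ~~ d i.
Proof. by case: fd. Qed.

Lemma walk_dirP i : d (i - 1) = ~~ d i.
Proof. by rewrite -[in RHS](subrK 1 i) walk_dirS negbK. Qed.

Lemma walkP i : f (i - 1) = s (~~ d i) (f i).
Proof.
rewrite -[in RHS](subrK 1 i) walkS subrK -walk_dirP antipodeK //.
exact: walk_boundary.
Qed.

Lemma walk_dir_addn i n : d (i + n%:Z) = d i (+) odd n.
Proof.
elim: n => [|n IH]; first by rewrite addr0 addbF.
by rewrite PoszS addrA walk_dirS IH /= addbN.
Qed.

Lemma walk_reverse : walk (fun i => f (- i)) (fun i => d (- i - 1)).
Proof.
split=> i; first exact: walk_boundary.
  by rewrite opprD walkP walk_dirP.
by rewrite opprD walk_dirP.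
Qed.

Lemma walk_shift k : walk (fun i => f (i + k)) (fun i => d (i + k)).
Proof.
split=> i; first exact: walk_boundary.
  by rewrite addrAC walkS.
by rewrite addrAC walk_dirS.
Qed.

(** A point together with the next move determines the walk in both directions, since the antipode
    maps are involutions. *)
Lemma walk_meet (a b : int) : f a = f b -> d a = d b -> forall k, f (a + k) = f (b + k).
Proof.
move=> fab dab.
have fwd n : f (a + n%:Z) = f (b + n%:Z) /\ d (a + n%:Z) = d (b + n%:Z).
  elim: n => [|n [IH1 IH2]]; first by rewrite !addr0.
  by rewrite PoszS !addrA !walkS !walk_dirS IH1 IH2.
have bwd n : f (a - n%:Z) = f (b - n%:Z) /\ d (a - n%:Z) = d (b - n%:Z).
  elim: n => [|n [IH1 IH2]]; first by rewrite !subr0.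
  by rewrite PoszS !opprD !addrA !walkP !walk_dirP IH1 IH2.
by case=> n; [case: (fwd n) | rewrite NegzE; case: (bwd n.+1)].
Qed.

Lemma walk_mirror (a b : int) : f a = f b -> d a = ~~ d b ->
  forall n : nat, f (a + n%:Z) = f (b - n%:Z).
Proof.
move=> fab dab n; have [] // : f (a + n%:Z) = f (b - n%:Z) /\
  d (a + n%:Z) = ~~ d (b - n%:Z).
elim: n => [|n [IH1 IH2]]; first by rewrite !addr0 ?subr0.
by rewrite PoszS opprD !addrA walkS walkP walk_dirS walk_dirP IH1 IH2.
Qed.

(** Otherwise [n] is odd and the stretch from [a] to [a + n] is a palindrome, so its two middle
    points agree and the walk stands still between them. *)
Lemma walk_meet_dir (a : int) (n : nat) :
  (forall i, a <= i < a + n%:Z -> f (i + 1) <> f i) ->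
  f a = f (a + n%:Z) -> d a = d (a + n%:Z).
Proof.
move=> nb fab; rewrite walk_dir_addn.
have [odd_n|] := boolP (odd n); last by rewrite addbF.
exfalso; apply: (nb (a + n./2%:Z)); first lia.
have := @walk_mirror a (a + n%:Z) fab; rewrite walk_dir_addn odd_n addbT negbK.
move=> /(_ erefl n./2) ->; congr (f _).
by have := odd_double_half n; rewrite odd_n; lia.
Qed.

Lemma walk_meet_run (a b : nat) : (a <= b)%N ->
  (forall i : nat, (a <= i < b)%N -> f (i%:Z + 1) <> f i%:Z) ->
  f a%:Z = f b%:Z -> forall k, f (a%:Z + k) = f (b%:Z + k).
Proof.
move=> ab nb e; have eb : b%:Z = a%:Z + (b - a)%N%:Z by lia.
apply: walk_meet => //; rewrite eb; apply: walk_meet_dir; last by rewrite -eb.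
move=> i ib; have -> : i = `|i|%N%:Z by lia.
by apply: nb; lia.
Qed.

(* I is the maximal interval around 0 on which the walk never stands still. *)
Definition walk_itv (I : interval int) :=
  [/\ 0 \in I, forall i, i \in I -> (i + 1 \in I <-> f (i + 1) <> f i) &
      forall i, i \in I -> (i - 1 \in I <-> f (i - 1) <> f i)].

Lemma walk_itv_exists : exists I, walk_itv I.
Proof.
have [u [u0 uS]] : exists u : itv_bound int, (BRight 0 <= u)%O /\
    forall i, 0 <= i -> (BRight i <= u)%O ->
      ((BRight (i + 1) <= u)%O <-> f (i + 1) <> f i).
  have [exb|nb] := pselect (exists n : nat, `[< f (n%:Z + 1) = f n%:Z >]).
    case: (ex_minnP exb) => n /asboolP fn minn.
    exists (BRight n%:Z); split=> // -[i _|//]; rewrite !bnd_simp => i_n.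
    split=> [i1n fi|fi].
      by have /minn := (asboolT fi); lia.
    have [e|] := eqVneq i n; first by rewrite e in fi.
    by move: i_n; lia.
  exists +oo%O; split=> // -[i _ _|//]; split=> // _ fi.
  by apply: nb; exists i; exact/asboolP.
have [l [l0 lS]] : exists l : itv_bound int, (l <= BLeft 0)%O /\
    forall i, i <= 0 -> (l <= BLeft i)%O ->
      ((l <= BLeft (i - 1))%O <-> f (i - 1) <> f i).
  have [exb|nb] := pselect (exists n : nat, `[< f (- n%:Z - 1) = f (- n%:Z) >]).
    case: (ex_minnP exb) => n /asboolP fn minn.
    exists (BLeft (- n%:Z)); split; first by rewrite bnd_simp; lia.
    move=> i i0; rewrite !bnd_simp => i_n.
    have ei : i = - (`|i|%N)%:Z by lia.
    split=> [i1n fi|fi].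
      by rewrite ei in fi; have /minn := (asboolT fi); lia.
    have [e|] := eqVneq i (- n%:Z); first by rewrite e in fi.
    by move: i_n; lia.
  exists -oo%O; split=> // i i0 _; split=> // _ fi.
  have ei : i = - (`|i|%N)%:Z by lia.
  by apply: nb; exists `|i|%N; apply/asboolP; rewrite -ei.
have ul i : 0 <= i -> (l <= BLeft i)%O.
  by move=> i0; apply: le_trans l0 _; rewrite bnd_simp.
have lu i : i <= 0 -> (BRight i <= u)%O.
  by move=> i0; apply: le_trans _ u0; rewrite bnd_simp.
have fdS i : f (i + 1) <> f i <-> f (i + 1 - 1) <> f (i + 1).
  by rewrite addrK; split; apply: nesym.
exists (Interval l u); split=> [|i|i]; rewrite !itv_boundlr ?l0 ?u0 // => /andP[li iu].
- have [i0|i0] := leP 0 i.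
    rewrite ul ?andTb; last lia.
    exact: uS.
  rewrite lu ?andbT; last lia.
  have li' : (l <= BLeft (i + 1))%O by apply: le_trans li _; rewrite bnd_simp; lia.
  have i1 : i + 1 <= 0 by lia.
  by rewrite fdS -(lS _ i1 li') addrK li li'.
- have [i0|i0] := leP i 0.
    rewrite lu ?andbT; last lia.
    exact: lS.
  rewrite ul ?andTb; last lia.
  have /uS h : (0 <= i - 1) by lia.
  have iu' : (BRight (i - 1) <= u)%O.
    by apply: le_trans _ iu; rewrite bnd_simp; lia.
  have := h iu'; rewrite subrK => h'; split=> [_|_]; last exact: iu'.
  by apply: nesym; apply/h'.
Qed.

Section Maximal.
Variable I : interval int.
Hypothesis fI : walk_itv I.

(** Where the walk stands still, a prolongation would have to use the other move, and thus go back
    along the last chord; this repeats a move type and violates alternation. The argument is made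
    once for each end. *)
Lemma walk_extended : extended_trajectory B P I f.
Proof.
have [I0 IS IP] := fI.
split.
  split=> [i _|]; first exact: walk_boundary.
  exists d; split=> [i iI /(IS _ iI)|i _ _ _]; first by rewrite walkS.
  by rewrite walk_dirS; case: (d i).
move=> I' b' [bd' [r' [step' alt']]] sub eqb.
have b'E i : i \in I -> b' i = f i by move=> /eqb.
have stepS j : j \in I -> j + 1 \in I' -> j + 1 \in I.
  move=> jI jI'; apply/(IS _ jI) => fj.
  have [e ne] := step' j (sub _ jI) jI'; rewrite (b'E j) // in e ne.
  have r'j : r' j = ~~ d j.
    apply/eqP; rewrite -[_ == _]negbK; apply/negP => hr; apply: ne.
    rewrite e (_ : r' j = d j) -?walkS //.
    by move: hr; case: (r' _); case: (d j).
  have fP : f (j - 1) <> f j by rewrite walkP -r'j -e.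
  have jP := (IP _ jI).2 fP.
  have := alt' (j - 1) (sub _ jP); rewrite subrK (_ : j - 1 + 2 = j + 1); last lia.
  move=> /(_ (sub _ jI) jI') alt.
  have [] := step' (j - 1) (sub _ jP); rewrite subrK ?(sub _ jI) //.
  rewrite !b'E // => e' _.
  have h1 : chord (r' (j - 1)) (f (j - 1)) (f j).
    rewrite e'; apply: antipode_chord; first exact: walk_boundary.
    by rewrite -e'; exact: nesym.
  have h2 : chord (d (j - 1)) (f (j - 1)) (f j).
    rewrite -[in f j](subrK 1 j) walkS; apply: antipode_chord.
      exact: walk_boundary.
    by rewrite -walkS subrK; exact: nesym.
  have := chord_dir_unique h1 h2; rewrite walk_dirP => h.
  by move: alt; rewrite r'j h; case: (d j).
have stepP j : j \in I -> j - 1 \in I' -> j - 1 \in I.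
  move=> jI jI'; apply/(IP _ jI) => fj.
  have jI'' := sub _ jI.
  have [] := step' (j - 1) jI'; rewrite subrK // (b'E j) // => e ne.
  have h : chord (r' (j - 1)) (f j) (b' (j - 1)).
    by apply: chordC; rewrite e; apply: antipode_chord; [exact: bd' | rewrite -e].
  have r'j : r' (j - 1) = d j.
    apply/eqP; rewrite -[_ == _]negbK; apply/negP => hr; apply: ne.
    rewrite (chord_antipode h) (_ : r' _ = ~~ d j) -?walkP ?fj //.
    by move: hr; case: (r' _); case: (d j).
  have fS : f (j + 1) <> f j.
    by rewrite walkS -r'j -(chord_antipode h); exact: nesym.
  have jS := (IS _ jI).2 fS.
  have := alt' (j - 1) jI'; rewrite subrK (_ : j - 1 + 2 = j + 1); last lia.
  move=> /(_ jI'' (sub _ jS)) alt.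
  have [e' ne'] := step' j jI'' (sub _ jS).
  rewrite (b'E j) // (b'E (j + 1)) // in e' ne'.
  have h1 : chord (r' j) (f j) (f (j + 1)).
    by rewrite e'; apply: antipode_chord; [exact: walk_boundary | rewrite -e'].
  have h2 : chord (d j) (f j) (f (j + 1)).
    by rewrite walkS; apply: antipode_chord; [exact: walk_boundary | rewrite -walkS].
  have h3 := chord_dir_unique h1 h2.
  by move: alt; rewrite r'j h3 eqxx.
move=> i; apply/idP/idP; last exact: sub.
have I'0 := sub _ I0.
case: i => n.
  elim: n => [//|n IH]; rewrite PoszS => iI'.
  by apply: stepS => //; apply: IH; apply: (itv_int_convex I'0 iI'); lia.
rewrite NegzE; elim: n => [|n IH] iI'.
  by rewrite -[- 1]add0r; apply: stepP; rewrite ?add0r.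
have e : - n.+2%:Z = - n.+1%:Z - 1 by lia.
rewrite e; apply: stepP; last by rewrite -e.
by apply: IH; apply: (itv_int_convex iI' I'0); lia.
Qed.

Lemma walk_itv_run (n : nat) :
  (forall i : nat, (i < n)%N -> f (i%:Z + 1) <> f i%:Z) ->
  forall i : nat, (i <= n)%N -> i%:Z \in I.
Proof.
have [I0 IS _] := fI; move=> h; elim=> [//|i IH] lt_in.
rewrite PoszS; apply/(IS _ (IH (ltnW lt_in))); exact: h.
Qed.

Lemma walk_itv_full : (forall i, f (i + 1) <> f i) -> forall i, i \in I.
Proof.
have [I0 IS IP] := fI; move=> h [] n.
  by apply: (walk_itv_run (n := n)) => // i _; exact: h.
rewrite NegzE; elim: n.+1 => [//|k IH].
rewrite (_ : - k.+1%:Z = - k%:Z - 1); last lia.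
by apply/(IP _ IH); have := h (- k%:Z - 1); rewrite subrK; exact: nesym.
Qed.

Lemma walk_trajectory (n : nat) :
  (forall i : nat, (i < n)%N -> f (i%:Z + 1) <> f i%:Z) ->
  {in [pred i : nat | i <= n]%N &, injective (fun i : nat => f i%:Z)} ->
  trajectory_at B P I f 0 (mkseq (fun i : nat => f i%:Z) n.+1).
Proof.
move=> run inj; split.
- exact: walk_extended.
- by rewrite size_mkseq.
- by rewrite size_mkseq => i lt_in; rewrite add0r (walk_itv_run run).
- by rewrite size_mkseq; apply: eq_mkseq => i; rewrite add0r.
- by apply/mkseq_uniqP => i j; rewrite !inE !ltnS => ? ? /inj; apply.
Qed.

End Maximal.
End OneWalk.

Lemma alternating_chord I b i : Defs.alternating B P I b -> i \in I -> i + 1 \in I ->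
  exists r, chord r (b i) (b (i + 1)).
Proof.
move=> [bd [r [st _]]] iI iI1; exists (r i); have [e ne] := st _ iI iI1.
by rewrite e; apply: antipode_chord; [exact: bd | rewrite -e].
Qed.

(** The entries of [u] are consecutive values of [b]; the boolean [m - 1 \in I], read as 0 or 1, is
    the shift caused by a prepended point. *)
Lemma augmentation_nth I b (m : int) t u : trajectory_at B P I b m t ->
  u = (if m - 1 \in I then [:: b (m - 1)] else [::]) ++ t ++
        (if m + (size t)%:Z \in I then [:: b (m + (size t)%:Z)] else [::]) ->
  size u = ((m - 1 \in I)%R + size t + (m + (size t)%:Z \in I)%R)%N /\
  forall k : nat, (k < size u)%N ->
    u`_k = b (m - (m - 1 \in I)%:Z + k%:Z) /\ m - (m - 1 \in I)%:Z + k%:Z \in I.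
Proof.
move=> [_ t0 tI tE _] ->.
have tn k : (k < size t)%N -> t`_k = b (m + k%:Z).
  by move=> kt; rewrite {1}tE nth_mkseq.
have sz : size ((if m - 1 \in I then [:: b (m - 1)] else [::]) ++ t ++
    (if m + (size t)%:Z \in I then [:: b (m + (size t)%:Z)] else [::])) =
    ((m - 1 \in I)%R + size t + (m + (size t)%:Z \in I)%R)%N.
  by rewrite !size_cat addnA; congr (_ + _ + _)%N; case: ifP.
split=> // k; rewrite sz nth_cat nth_cat => ksz.
case: (boolP (m - 1 \in I)) ksz => mI /= ksz.
  case: k ksz => [|k] ksz /=; first by rewrite addr0.
  rewrite subSS subn0 (_ : m - 1 + k.+1%:Z = m + k%:Z); last lia.
  have [kt|kt] := ltnP k (size t); first by rewrite tn // tI.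
  case: ifP ksz => mI' ksz; last lia.
  have -> : k = size t by lia.
  by rewrite subnn mI'.
rewrite subr0 subn0; have [kt|kt] := ltnP k (size t); first by rewrite tn // tI.
case: ifP ksz => mI' ksz; last lia.
have -> : k = size t by lia.
by rewrite subnn mI'.
Qed.

(** Every edge has an end in [t]: the second one for a prepended edge, the first one otherwise. *)
Lemma augmentation_edge t u (k : nat) : augmentation B P t u -> (k.+1 < size u)%N ->
  exists2 r, chord r u`_k u`_k.+1 & exists2 x, x \in t & mu r x = mu r u`_k.
Proof.
move=> [I [b [m [tr uE]]]] ksz.
have [sz un] := augmentation_nth tr uE; have [[alt _] t0 tI tE _] := tr.
have tn (j : nat) : (j < size t)%N -> b (m + j%:Z) \in t.
  by move=> jt; rewrite [X in _ \in X]tE; apply/mapP; exists j; rewrite ?mem_iota.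
have [e1 I1] := un _ (ltnW ksz); have [e2 I2] := un _ ksz.
have eS : m - (m - 1 \in I)%:Z + k.+1%:Z = m - (m - 1 \in I)%:Z + k%:Z + 1 by lia.
rewrite eS in e2 I2; have [r ch] := alternating_chord alt I1 I2.
rewrite -e1 -e2 in ch; exists r => //.
have [kz|kz] := boolP ((m - 1 \in I) && (k == 0)%N).
  exists u`_k.+1; last by case: ch.
  rewrite e2; case/andP: kz => -> /eqP ->.
  by rewrite (_ : _ + 1 = m + 0%:Z) ?tn //; lia.
exists u`_k => //; rewrite e1.
have [j jE jt] : exists2 j : nat,
    m - (m - 1 \in I)%:Z + k%:Z = m + j%:Z & (j < size t)%N.
  move: kz ksz; rewrite sz; case: (m - 1 \in I) => /= kz ksz.
    exists k.-1; first by case: k kz {ksz e1 e2 I1 I2 eS ch} => //= k _; lia.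
    by case: (m + _ \in I) ksz => /=; lia.
  by exists k; [lia | case: (m + _ \in I) ksz => /=; lia].
by rewrite jE tn.
Qed.

Lemma augmentation_has_edge I b (m : int) t i : trajectory_at B P I b m t ->
  i \in I -> i + 1 \in I -> m - 1 <= i <= m + (size t)%:Z - 1 ->
  exists u k, [/\ augmentation B P t u, (k.+1 < size u)%N,
    u`_k = b i & u`_k.+1 = b (i + 1)].
Proof.
move=> tr iI iI1 ib.
set u := (if m - 1 \in I then [:: b (m - 1)] else [::]) ++ t ++
        (if m + (size t)%:Z \in I then [:: b (m + (size t)%:Z)] else [::]).
have [sz un] := augmentation_nth tr (erefl u).
have mI : (m - 1 \in I) || (m <= i).
  have [//|im] := leP m i; first by rewrite orbT.
  by rewrite (_ : m - 1 = i) ?iI //; lia.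
have mI' : (m + (size t)%:Z \in I) || (i + 1 < m + (size t)%:Z).
  have [//|im] := ltP (i + 1) (m + (size t)%:Z); first by rewrite orbT.
  by rewrite (_ : m + _ = i + 1) ?iI1 //; lia.
exists u, `|(i - m + (m - 1 \in I)%:Z)%R|%N.
have ksz : (`|(i - m + (m - 1 \in I)%:Z)%R|.+1 < size u)%N.
  move: mI mI'; rewrite sz.
  by case: (m - 1 \in I); case: (m + _ \in I) => /=; lia.
have iE : m - (m - 1 \in I)%:Z + (`|(i - m + (m - 1 \in I)%:Z)%R|%N)%:Z = i.
  by move: mI; case: (m - 1 \in I) => /=; lia.
split=> //; first by exists I, b, m.
  by have [-> _] := un _ (ltnW ksz); rewrite iE.
have [-> _] := un _ ksz; congr (b _); move: iE; case: (m - 1 \in I) => /=; lia.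
Qed.

End Walks.

(** * Infinitesimal motions *)

Section Tangent.
Variables (R : realType) (B : board R) (P : two_move_rider) (q : nat).
Implicit Types (z v w : 'M[R]_(q, 2)) (e : equation B q).

Local Notation mu := (@move_coord R P).
Local Notation n := (side_normal (@corner R B)).
Local Notation o := (side_offset (@corner R B)).

Lemma eqn_lhsD e z w : eqn_lhs P e (z + w) = eqn_lhs P e z + eqn_lhs P e w.
Proof.
have rowD k : row k (z + w) = row k z + row k w by apply/rowP => j; rewrite !mxE.
case: e => [[[r i] j]|[k i]] /=; rewrite !rowD ?dotDr //.
by rewrite !dotBl !dotDl; ring.
Qed.

Lemma eqn_lhsZ e (a : R) z : eqn_lhs P e (a *: z) = a * eqn_lhs P e z.
Proof.
have rowZ k : row k (a *: z) = a *: row k z by apply/rowP => j; rewrite !mxE.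
case: e => [[[r i] j]|[k i]] /=; rewrite !rowZ ?dotZr //.
by rewrite -scalerBr dotZl.
Qed.

Lemma eqn_lhs0 e : eqn_lhs P e 0 = 0.
Proof. by rewrite -(scale0r 0) eqn_lhsZ mul0r. Qed.

Lemma eqn_lhsB e z w : eqn_lhs P e (z - w) = eqn_lhs P e z - eqn_lhs P e w.
Proof. by rewrite -scaleN1r eqn_lhsD eqn_lhsZ mulN1r. Qed.

Lemma eqn_lhsE e z : eqn_lhs P e z = \sum_i \sum_j eqn_coef P e i j * z i j.
Proof.
rewrite {1}[z]matrix_sum_delta (big_morph _ (eqn_lhsD e) (eqn_lhs0 e)).
apply: eq_bigr => i _; rewrite (big_morph _ (eqn_lhsD e) (eqn_lhs0 e)).
by apply: eq_bigr => j _; rewrite eqn_lhsZ mxE mulrC.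
Qed.

(** The infinitesimal motions of [z], that is, the kernel of the linear parts of the equations
    through [z]. *)
Definition tangent z v := forall e, e \in eqns_at B P z -> eqn_lhs P e v = 0.

(** Adding a tangent vector to [z] preserves every equation through [z], in particular any chosen
    collection; conversely, the collection of all equations through [z] serves. *)
Lemma vertexP z : (forall i, region B (row i z)) ->
  is_vertex B P z <-> forall v, tangent z v -> v = 0.
Proof.
move=> hz; split=> [[_ [C Ceq Cz]] v tv|h].
  have zC e : e \in C -> eqn_holds P e z by move: e; exact: (Cz z).2.
  have /Cz : forall e, e \in C -> eqn_holds P e (z + v).
    move=> e eC; rewrite /eqn_holds eqn_lhsD tv ?addr0; first exact: zC.
    by rewrite inE (fintype.subsetP Ceq) //= zC.
  by rewrite -[in RHS](addr0 z) => /addrI.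
split=> //; exists (eqns_at B P z).
  by apply/fintype.subsetP => e; rewrite inE => /andP[].
move=> w; split=> [hw|-> e]; last by rewrite inE => /andP[].
apply/eqP; rewrite -subr_eq0; apply/eqP/h => e eH.
rewrite eqn_lhsB (eqP (hw e eH)); move: eH; rewrite inE => /andP[_ /eqP ->].
by rewrite subrr.
Qed.

(** Tangent vectors, flattened by [mxvec], form the left kernel of the transposed coefficient
    matrix, and full rank means that this kernel is trivial. *)
Lemma full_rankP z : full_rank B P z <-> forall v, tangent z v -> v = 0.
Proof.
rewrite /full_rank /config_rank; set A := \matrix_k _.
have AE v k : (mxvec v *m A^T) 0 k = eqn_lhs P (enum_val k) v.
  rewrite eqn_lhsE mxE pair_bigA /= (reindex _ (curry_mxvec_bij _ _)) /=.
  by apply: eq_bigr => -[i j] _ /=; rewrite [A^T _ _]mxE [A _ _]mxE !mxvecE mulrC.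
have tAP v : tangent z v <-> mxvec v *m A^T = 0.
  split=> [tv|h e eH].
    by apply/rowP => k; rewrite AE mxE tv // enum_valP.
  by rewrite -[e](enum_rankK_in eH eH) -AE h mxE.
rewrite -mxrank_tr [RHS in _ = RHS]mulnC; split=> [rk v /tAP|h].
  have free : row_free A^T by apply/eqP.
  move=> /eqP; rewrite mulmx_free_eq0 // => /eqP v0.
  by rewrite -[v]mxvecK v0 linear0.
suff /eqP : row_free A^T by [].
rewrite -kermx_eq0; apply/eqP/row_matrixP => i; rewrite row0.
have : tangent z (vec_mx (row i (kermx A^T))).
  by apply/tAP; rewrite vec_mxK -row_mul mulmx_ker row0.
by move=> /h /(congr1 mxvec); rewrite vec_mxK linear0.
Qed.

Lemma tangentP z v : tangent z v <->
  (forall r i j, mu r (row i z) = mu r (row j z) ->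
     mu r (row i v) = mu r (row j v)) /\
  (forall k i, dot (n k) (row i z) = o k -> dot (n k) (row i v) = 0).
Proof.
split=> [tv|[h1 h2] e].
  split=> [r i j e|k i e].
    have [->//|ij] := eqVneq i j.
    apply/eqP; rewrite -subr_eq0 -move_coordB; apply/eqP.
    apply: (tv (inl (r, i, j))); rewrite !inE ij /=.
    by rewrite /eqn_holds /= [X in X == _]move_coordB e subrr.
  apply: (tv (inr (k, i))); rewrite !inE /=.
  by rewrite /eqn_holds /= e.
rewrite inE => /andP[_]; case: e => [[[r i] j]|[k i]]; rewrite /eqn_holds /=.
  rewrite [X in X == _]move_coordB subr_eq0 => /eqP/h1 e.
  by rewrite [LHS]move_coordB e subrr.
by move=> /eqP/h2.
Qed.

End Tangent.

(** * What the absence of infinitesimal motions forces *)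

Section Rigidity.
Variables (R : realType) (B : board R) (P : two_move_rider) (q : nat).
Variable z : 'M[R]_(q, 2).
Hypothesis hz : forall i, region B (row i z).
Implicit Types (x y c : 'rV[R]_2) (r : bool).

Local Notation mu := (@move_coord R P).
Local Notation n := (side_normal (@corner R B)).
Local Notation o := (side_offset (@corner R B)).
Local Notation s := (antipode B P).

Definition placed x := exists i, row i z = x.
Definition noncorner x := forall k, x != @corner R B k.

Lemma side_kernel k (v : 'rV[R]_2) :
  dot (n k) v = 0 -> exists t, v = t *: perp (n k).
Proof.
move=> e; apply: dot_perp_eq0_collinear.
  by apply: contra_neq (normal_neq0 k); apply: perp_eq0.
by rewrite perpK dotC -scaleN1r dotZl e mulr0.
Qed.

Hypothesis rigid : forall v, tangent B P z v -> v = 0.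

(* Translating the move lines by [delta] induces a displacement of all points. *)
Lemma line_translation_trivial (delta : bool -> R -> R) :
  (forall k i v, dot (n k) (row i z) = o k ->
     (forall r, mu r v = delta r (mu r (row i z))) -> dot (n k) v = 0) ->
  forall i r, delta r (mu r (row i z)) = 0.
Proof.
move=> fixd.
have [V VP] := choice
  (fun i => move_coord_surj P (fun r => delta r (mu r (row i z)))).
have /rigid V0 : tangent B P z (\matrix_i V i).
  apply/tangentP; split=> [r i j e|k i e]; first by rewrite !rowK !VP e.
  by rewrite rowK; apply: fixd e _ => r; exact: VP.
move=> i r; rewrite -VP -[V i](rowK V) V0 row0; exact: dot0l.
Qed.

(** Otherwise this one line can be translated alone: only interior points move with it, and they
    satisfy no fixation. *)
Lemma placed_on_line r c : inside B c -> placed c ->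
  exists y, [/\ placed y, boundary B y & mu r y = mu r c].
Proof.
move=> Ic [i0 e0]; apply: contrapT => no.
pose delta r' a : R := if (r' == r) && (a == mu r c) then 1 else 0.
suff /line_translation_trivial/(_ i0 r) : forall k i v,
    dot (n k) (row i z) = o k ->
    (forall r', mu r' v = delta r' (mu r' (row i z))) -> dot (n k) v = 0.
  by rewrite e0 /delta !eqxx /= => /eqP; rewrite oner_eq0.
move=> k i v ek vE; suff -> : v = 0 by rewrite dot0r.
apply: (@move_coord_eq0 _ P) => r'; rewrite vE /delta.
case: ifP => // /andP[/eqP -> /eqP e]; case: no; exists (row i z).
split=> //; first by exists i.
exact: region_boundary (hz i) ek.
Qed.

(** A motion of [X] extends to the whole configuration by zero on every line that misses [X], so
    rigidity kills it. The extension is consistent because a boundary point outside [X] can share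
    with a point of [X] only a line along a side, and motion along that side does not shift this
    line. *)
Lemma closed_motion_trivial (X : set 'rV[R]_2) (v : 'rV[R]_2 -> 'rV[R]_2) :
  (forall x, X x -> [/\ placed x, boundary B x & noncorner x]) ->
  (forall r x y, X x -> placed y -> boundary B y -> crosses B P r x ->
     mu r y = mu r x -> X y) ->
  (forall k x, X x -> dot (n k) x = o k -> dot (n k) (v x) = 0) ->
  (forall r x y, X x -> X y -> mu r x = mu r y -> mu r (v x) = mu r (v y)) ->
  forall x, X x -> v x = 0.
Proof.
move=> XS Xcl Xfix Xatt.
(* The displacement of a line is read off any point of [X] on it; compatibility of [v] makes the
   choice immaterial. *)
pose delta r a : R := if pselect (exists2 x, X x & mu r x = a) is left h
  then mu r (v (s2val (cid2 h))) else 0.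
have deltaX r x : X x -> delta r (mu r x) = mu r (v x).
  move=> Xx; rewrite /delta; case: pselect => [h|[]]; last by exists x.
  by case: (cid2 h) => y Xy e /=; exact: Xatt.
have delta0 r y : placed y -> boundary B y -> ~ X y -> delta r (mu r y) = 0.
  move=> py by_ nXy; rewrite /delta; case: pselect => // h.
  case: (cid2 h) => x Xx e /=; have [_ bx ncx] := XS _ Xx.
  have ncr : ~ crosses B P r x by move=> cr; apply: nXy; apply: Xcl cr _; rewrite ?e.
  have /boundaryP[_ [k ek]] := bx.
  have [t ->] := side_kernel (Xfix _ _ Xx ek); rewrite move_coordZ.
  suff -> : mu r (perp (n k)) = 0 by rewrite mulr0.
  apply/eqP/negPn/negP => h0; apply: ncr.
  exact: (noncorner_crosses P r bx ncx ek).2.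
have d0 : forall i r, delta r (mu r (row i z)) = 0.
  apply: line_translation_trivial => k i w ek wE.
  have bi := region_boundary (hz i) ek.
  have [Xi|nXi] := pselect (X (row i z)).
    have -> : w = v (row i z).
      by apply: (@move_coord_inj _ P) => r; rewrite wE deltaX.
    exact: Xfix.
  suff -> : w = 0 by rewrite dot0r.
  by apply: (@move_coord_eq0 _ P) => r; rewrite wE delta0 //; exists i.
move=> x Xx; apply: (@move_coord_eq0 _ P) => r; rewrite -deltaX //.
by have [[i <-] _ _] := XS _ Xx.
Qed.

(* A corner-free trajectory that cannot be prolonged inside the configuration
   can slide along the sides: each point moves along its own side, the speeds
   being matched along the chords. *)
Lemma corner_free_path_false g d (L : nat) : walk B P g d ->
  (forall i : nat, (i <= L)%N -> placed (g i%:Z) /\ noncorner (g i%:Z)) ->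
  (forall i : nat, (i < L)%N -> g (i%:Z + 1) <> g i%:Z) ->
  g (L%:Z + 1) = g L%:Z \/ ~ placed (g (L%:Z + 1)) ->
  g (- 1) = g 0 \/ ~ placed (g (- 1)) -> False.
Proof.
move=> gd gS run stopR stopL.
have gb (i : nat) : boundary B (g i%:Z) := walk_boundary gd i.
have inj : {in [pred i : nat | i <= L]%N &, injective (fun i : nat => g i%:Z)}.
  (* A repetition would make the walk periodic, and the step leaving [L] would copy an earlier step
     of the path, contradicting the stop at [L]. *)
  apply: inj_le_of_lt => a b bL ab e.
  have meet k : g (a%:Z + k) = g (b%:Z + k).
    by apply: (walk_meet_run gd (ltnW ab)) => // i ib; apply: run; lia.
  have e1 : g (L%:Z + 1) = g (L - (b - a))%N.+1%:Z.
    transitivity (g (b%:Z + (L%:Z + 1 - b%:Z))); first by congr g; lia.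
    by rewrite -meet; congr g; lia.
  have e2 : g L%:Z = g (L - (b - a))%N%:Z.
    transitivity (g (b%:Z + (L%:Z - b%:Z))); first by congr g; lia.
    by rewrite -meet; congr g; lia.
  case: stopR => [|[]]; last by rewrite e1; apply: (gS _ _).1; lia.
  by rewrite e1 e2 PoszS; apply: run; lia.
(* Along a crossing line, a point of the path meets no other placed boundary point than its
   neighbours on the path. *)
have nb r y (i : nat) : (i <= L)%N -> placed y -> boundary B y ->
    mu r y = mu r (g i%:Z) -> crosses B P r (g i%:Z) ->
    [\/ y = g i%:Z, [/\ (i < L)%N, r = d i%:Z & y = g i.+1%:Z]
      | exists i' : nat, [/\ i = i'.+1, r = d i'%:Z & y = g i'%:Z]].
  move=> iL py by_ e cr; have [yg|yg] := pselect (y = g i%:Z); first by constructor 1.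
  have ys := antipode_unique (gb i) by_ cr e yg.
  have [rd|rd] := eqVneq r (d i%:Z).
    have ys' : y = g (i%:Z + 1) by rewrite ys rd (walkS gd).
    constructor 2; split=> //; last by rewrite PoszS.
    rewrite ltn_neqAle iL andbT; apply/eqP => eL.
    by case: stopR; rewrite -eL -ys'.
  have rd' : r = ~~ d i%:Z by case: (r) (d i%:Z) rd => -[].
  have ys' : y = g (i%:Z - 1) by rewrite ys rd' (walkP gd).
  constructor 3; case: i iL e cr yg ys rd rd' ys' => [|i] iL e cr yg ys rd rd' ys'.
    by case: stopL; rewrite (_ : - 1 = 0%:Z - 1) // -ys'.
  exists i; split=> //; last by rewrite ys'; congr g; lia.
  by rewrite rd' PoszS (walk_dirS gd) negbK.
have [K KP] := choice (fun i : nat => ((boundaryP B (g i%:Z)).1 (gb i)).2).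
pose D i := perp (n (K i)).
(* The speeds start at 1, and each next one is chosen so that both ends shift their common chord
   equally; the divisor is nonzero because this chord crosses the interior. *)
pose c := fix c (i : nat) : R := if i is i'.+1
  then c i' * mu (d i'%:Z) (D i') / mu (d i'%:Z) (D i'.+1) else 1.
pose t := mkseq (fun i : nat => g i%:Z) L.+1.
have tP x : x \in t <-> exists2 i : nat, (i <= L)%N & x = g i%:Z.
  split=> [/mapP[i]|[i iL ->]]; first by rewrite mem_iota => iL ->; exists i.
  by apply/mapP; exists i => //; rewrite mem_iota.
pose v x := c (index x t) *: D (index x t).
have vE (i : nat) : (i <= L)%N -> v (g i%:Z) = c i *: D i.
  move=> iL; rewrite /v; have -> : index (g i%:Z) t = i; last by [].
  rewrite -[g i%:Z](nth_mkseq 0 (fun i : nat => g i%:Z) (n := L.+1)) // index_uniq //.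
    by rewrite size_mkseq.
  by apply/mkseq_uniqP => a b; rewrite !inE !ltnS => ? ? /inj; apply.
have Dcr r (i : nat) : (i <= L)%N -> crosses B P r (g i%:Z) <-> mu r (D i) != 0.
  by move=> iL; apply: noncorner_crosses => //; have [] := gS i iL.
have step (i : nat) : (i < L)%N ->
    mu (d i%:Z) (v (g i%:Z)) = mu (d i%:Z) (v (g i.+1%:Z)).
  move=> iL; rewrite !vE ?(ltnW iL) // !move_coordZ /= divfK //.
  apply/(Dcr _ i.+1 iL); apply: (@crosses_coord _ _ _ _ (g i%:Z)).
    by rewrite PoszS (walkS gd) antipode_coord.
  by apply: antipode_neq; rewrite -(walkS gd); exact: run.
have v0 : v (g 0%:Z) = 0.
  apply: (@closed_motion_trivial [set` t]); last by apply/tP; exists 0%N.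
  - by move=> x /tP[i iL ->]; have [? ?] := gS i iL; split=> //; exact: gb.
  - move=> r x y /tP[i iL ->] py by_ cr e; apply/tP.
    case: (nb r y i iL py by_ e cr) => [->|[iL' _ ->]|[i' [ei _ ->]]].
    + by exists i.
    + by exists i.+1.
    + by exists i' => //; lia.
  - move=> k x /tP[i iL ->] ek; rewrite vE // dotZr.
    have [_ nc] := gS i iL.
    rewrite (noncorner_side_unique (boundary_region (gb i)) nc (KP i) ek).
    by rewrite dot_perp mulr0.
  - move=> r x y /tP[i iL ->] /tP[j jL ->] e.
    have [cr|ncr] := pselect (crosses B P r (g i%:Z)); last first.
      have z0 (k : nat) : (k <= L)%N -> mu r (g k%:Z) = mu r (g i%:Z) ->
          mu r (v (g k%:Z)) = 0.
        move=> kL ek; rewrite vE // move_coordZ.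
        suff -> : mu r (D k) = 0 by rewrite mulr0.
        apply/eqP/negPn/negP => /(Dcr r k kL).2 h; apply: ncr.
        exact: crosses_coord h.
      by rewrite !z0.
    have [pj _] := gS j jL.
    case: (nb r _ i iL pj (gb j) (esym e) cr) => [->//|[iL' -> ->]|[i' [ei -> ->]]].
      exact: step.
    by subst i; rewrite -step.
move: v0; rewrite vE //= scale1r => /eqP; apply/negP.
by apply: contra_neq (normal_neq0 (K 0%N)); apply: perp_eq0.
Qed.

End Rigidity.

(** * Vertices and trajectories *)

Lemma has_period_muln (T : Type) (f : int -> T) (p : nat) : has_period f p ->
  forall (i : int) (k : nat), f (i + (k * p)%N%:Z) = f i.
Proof.
move=> fp i; elim=> [|k IH]; first by rewrite mul0n addr0.
by rewrite mulSn addnC PoszD addrA fp.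
Qed.

Section Covering.
Variables (R : realType) (B : board R) (P : two_move_rider) (q : nat).
Variable z : 'M[R]_(q, 2).
Hypothesis hz : forall i, region B (row i z).
Implicit Types (x y c p : 'rV[R]_2) (r : bool) (f : int -> 'rV[R]_2).

Local Notation mu := (@move_coord R P).
Local Notation s := (antipode B P).
Local Notation placed := (placed z).
Local Notation noncorner := (@noncorner R B).

(** The last clause says that some augmentation contains each chord issuing from a point of [t]; it
    is what places interior points on augmented segments. *)
Definition building_block (t : seq 'rV[R]_2) :=
  [/\ corner_trajectory B P t \/ rigid_cycle B P t,
      forall x, x \in t -> placed x /\ boundary B x &
      forall x r, x \in t -> crosses B P r x -> exists u k,
        [/\ augmentation B P t u, (k.+1 < size u)%N &
            u`_k = x /\ u`_k.+1 = s r x \/ u`_k = s r x /\ u`_k.+1 = x]].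

Definition run f (m : nat) :=
  (forall i : nat, (i <= m)%N -> placed (f i%:Z)) /\
  (forall i : nat, (i < m)%N -> f (i%:Z + 1) <> f i%:Z).

Lemma walk_building_block f d I (m : nat) :
  let t := mkseq (fun i : nat => f i%:Z) m.+1 in
  walk B P f d -> walk_itv f I -> run f m ->
  {in [pred i : nat | i <= m]%N &, injective (fun i : nat => f i%:Z)} ->
  corner_trajectory B P t \/ rigid_cycle B P t -> building_block t.
Proof.
move=> t fd fI [fS frun] inj ct.
have tr : trajectory_at B P I f 0 t := walk_trajectory fd fI frun inj.
have tP x : x \in t -> exists2 i : nat, (i <= m)%N & x = f i%:Z.
  by move=> /mapP[i]; rewrite mem_iota => im ->; exists i.
split=> // [x /tP[i im ->]|x r /tP[i im ->] cr].
  by split; [exact: fS | exact: walk_boundary fd _].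
have [I0 IS IP] := fI; have bi := walk_boundary fd i%:Z.
have iI : i%:Z \in I by apply: (walk_itv_run fI frun).
have [_ _ ne] := antipode_crosses bi cr.
have [rd|rd] := eqVneq r (d i%:Z).
  have e : s r (f i%:Z) = f (i%:Z + 1) by rewrite rd (walkS fd).
  have iI1 : i%:Z + 1 \in I by apply/(IS _ iI); rewrite -e.
  have [|u [k [au ku e1 e2]]] := augmentation_has_edge tr iI iI1.
    by rewrite size_mkseq; lia.
  by exists u, k; split=> //; left; rewrite e.
have rd' : r = ~~ d i%:Z by case: (r) (d i%:Z) rd => -[].
have e : s r (f i%:Z) = f (i%:Z - 1) by rewrite rd' (walkP fd).
have iI1 : i%:Z - 1 \in I by apply/(IP _ iI); rewrite -e.
have [||u [k [au ku e1 e2]]] := augmentation_has_edge tr iI1.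
- by rewrite subrK.
- by rewrite size_mkseq; lia.
by exists u, k; split=> //; right; rewrite e; move: e2; rewrite subrK.
Qed.

(** The run is cut at the first corner. Its points are then distinct, since a repetition would, by
    periodicity, produce that corner earlier. *)
Lemma corner_block f d (m : nat) : walk B P f d -> run f m -> ~ noncorner (f m%:Z) ->
  exists2 t, building_block t & f 0 \in t.
Proof.
move=> fd rm cm.
pose good m' := `[< run f m' /\ ~ noncorner (f m'%:Z) >].
have exg : exists m', good m' by exists m; apply/asboolP.
case: (ex_minnP exg) => {m rm cm} m /asboolP[rm cm] minm.
have [I fI] := walk_itv_exists f.
have inj : {in [pred i : nat | i <= m]%N &, injective (fun i : nat => f i%:Z)}.
  apply: inj_le_of_lt => a b bL ab e.
  have meet k : f (a%:Z + k) = f (b%:Z + k).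
    by apply: (walk_meet_run fd (ltnW ab)) => // i ib; apply: rm.2; lia.
  have e' : f m%:Z = f (m - (b - a))%N%:Z.
    transitivity (f (b%:Z + (m%:Z - b%:Z))); first by congr f; lia.
    by rewrite -meet; congr f; lia.
  have /minm : good (m - (b - a))%N; last by lia.
  apply/asboolP; split; last by rewrite -e'.
  by case: rm => rm1 rm2; split=> i im; [apply: rm1 | apply: rm2]; lia.
exists (mkseq (fun i : nat => f i%:Z) m.+1); last first.
  by apply/mapP; exists 0%N; rewrite ?mem_iota.
apply: (walk_building_block fd fI rm inj); left; split.
  by exists I, f, 0; apply: (walk_trajectory fd fI rm.2 inj).
move/existsNP: cm => [k /negP/negPn/eqP ek]; exists k; rewrite -ek.
by apply/mapP; exists m; rewrite ?mem_iota /= ?add0n ?ltnS.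
Qed.

Hypothesis rigid : forall v, tangent B P z v -> v = 0.

(** An endless run among finitely many placed points repeats, hence is periodic, and its least
    return time to [f 0] is the minimal period. Its point set is closed under chords, so a motion of
    the cycle alone extends to the configuration and vanishes. *)
Lemma cycle_block f d : walk B P f d -> (forall m, run f m) ->
  (forall m : nat, noncorner (f m%:Z)) -> exists2 t, building_block t & f 0 \in t.
Proof.
move=> fd rf nc.
have [a [b [ab eab]]] : exists a b : nat, (a < b)%N /\ f a%:Z = f b%:Z.
  have [g gP] := choice (fun i : nat => (rf i).1 i (leqnn i)).
  (* Pigeonhole: [q + 1] indices are carried by [q] pieces. *)
  have : ~ injective (fun i : 'I_q.+1 => g i).
    by move=> /leq_card; rewrite !card_ord ltnn.
  move=> /existsNP[i /existsNP[j /not_implyP[e ij]]].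
  have ij' : (i : nat) <> j by move=> /ord_inj.
  by case: (ltngtP i j) => // lt; [exists i, j | exists j, i];
    rewrite -!gP e.
have meet (a' b' : nat) : (a' <= b')%N -> f a'%:Z = f b'%:Z ->
    forall k, f (a'%:Z + k) = f (b'%:Z + k).
  by move=> ab' e; apply: (walk_meet_run fd) => // i _; exact: (rf i.+1).2.
have back (a' b' : nat) : (a' <= b')%N -> f a'%:Z = f b'%:Z ->
    f (b' - a')%N%:Z = f 0.
  move=> ab' e; transitivity (f (b'%:Z - a'%:Z)); first by congr f; lia.
  by rewrite -(meet _ _ ab' e) subrr.
have exp : exists p : nat, (0 < p)%N && (f p%:Z == f 0).
  by exists (b - a)%N; rewrite subn_gt0 ab; apply/eqP/back => //; exact: ltnW.
case: (ex_minnP exp) => {a b ab eab} p /andP[p0 /eqP fp] minp.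
have per : has_period f p.
  by move=> i; rewrite addrC -(meet 0%N p) ?add0r.
(* Adding [|i|] periods makes any index nonnegative, which transfers facts about the forward run to
   all of the walk. *)
have toN i : exists2 m : nat, f i = f m%:Z & f (i + 1) = f (m%:Z + 1).
  have ge0 : 0 <= i + (`|i| * p)%N%:Z by nia.
  exists `|(i + (`|i| * p)%N%:Z)%R|%N; rewrite gez0_abs //.
    by rewrite has_period_muln.
  by rewrite addrAC has_period_muln.
have inj : {in [pred i : nat | i <= p.-1]%N &, injective (fun i : nat => f i%:Z)}.
  apply: inj_le_of_lt => a b bp ab e; have := minp (b - a)%N.
  by rewrite (back _ _ (ltnW ab) e) eqxx subn_gt0 ab => /(_ isT); lia.
have nobreak i : f (i + 1) <> f i.
  by have [m -> ->] := toN i; apply: (rf m.+1).2.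
have [I fI] := walk_itv_exists f.
have pE : p = p.-1.+1 by lia.
set t := mkseq (fun i : nat => f i%:Z) p.-1.+1.
have szt : size t = p by rewrite size_mkseq -pE.
have tr : trajectory_at B P I f 0 t := walk_trajectory fd fI (rf _).2 inj.
have [_ _ _ _ ut] := tr.
have tn (i : nat) : (i < p)%N -> t`_i = f i%:Z.
  by move=> ip; rewrite nth_mkseq // -pE.
have tP x : x \in t <-> exists2 i : nat, (i < p)%N & x = f i%:Z.
  split=> [/mapP[i]|[i ip ->]]; first by rewrite mem_iota -pE => ip ->; exists i.
  by apply/mapP; exists i => //; rewrite mem_iota -pE.
have fP i : f i \in t.
  have [m -> _] := toN i; apply/tP; exists (m %% p)%N; first by rewrite ltn_mod.
  by rewrite [in LHS](divn_eq m p) addnC PoszD has_period_muln.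
exists t; last exact: fP.
apply: (walk_building_block fd fI (rf _) inj); right; split.
  exists I, f, 0; split=> //.
  - exact: walk_itv_full fI nobreak.
  - rewrite szt ltn_neqAle p0 andbT; apply/eqP => p1.
    by apply: (nobreak 0); rewrite add0r -fp -p1.
  - by rewrite szt.
  - move=> p'; rewrite szt => /andP[p'0 p'p] /(_ 0); rewrite add0r => fp'.
    by have := minp p'; rewrite p'0 fp' eqxx => /(_ isT); rewrite leqNgt p'p.
apply/full_rankP => v /tangentP[vatt vfix].
pose w i := if insub i is Some k then row (k : 'I_(size t)) v else 0.
pose vx x := w (index x t).
have vxE (k : 'I_(size t)) : vx t`_k = row k v.
  by rewrite /vx index_uniq // /w valK.
have rowt k : row k (\matrix_(i < size t) t`_i) = t`_k by rewrite rowK.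
have tk x : x \in t -> exists k : 'I_(size t), x = t`_k.
  move=> xt; have ix : (index x t < size t)%N by rewrite index_mem.
  by exists (Ordinal ix) => /=; rewrite nth_index.
apply/row_matrixP => k; rewrite row0 -vxE.
apply: (@closed_motion_trivial _ _ _ _ _ hz rigid [set` t]) => /=; last first.
- by rewrite mem_nth.
- move=> r x y /tk[i ->] /tk[j ->] e; rewrite !vxE; apply: vatt.
  by rewrite !rowt.
- move=> k' x /tk[i ->] e; rewrite vxE; apply: vfix; by rewrite rowt.
- move=> r x y /tP[i ip ->] py by_ cr e.
  have bi := walk_boundary fd i%:Z.
  have [->|yf] := pselect (y = f i%:Z); first exact: fP.
  rewrite (antipode_unique bi by_ cr e yf).
  have [->|rd] := eqVneq r (d i%:Z); first by rewrite -(walkS fd).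
  have -> : r = ~~ d i%:Z by case: (r) (d i%:Z) rd => -[].
  by rewrite -(walkP fd).
- move=> x /tP[i ip ->]; split; first exact: (rf i).1.
    exact: walk_boundary fd _.
  exact: nc.
Qed.

Lemma run_stop f : placed (f 0) -> ~ (forall m, run f m) -> exists m : nat,
  run f m /\ (f (m%:Z + 1) = f m%:Z \/ ~ placed (f (m%:Z + 1))).
Proof.
move=> p0 /existsNP[k]; elim: k => [|k IH] nk.
  by case: nk; split=> // i; rewrite leqn0 => /eqP ->.
have [rk|/IH//] := pselect (run f k).
exists k; split=> //; apply: contrapT => /not_orP[h1 /contrapT h2]; apply: nk.
case: rk => rk1 rk2; split=> i; rewrite ?ltnS leq_eqVlt => /predU1P[->|] //.
  by rewrite PoszS.
  by rewrite ltnS; exact: rk1.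
exact: rk2.
Qed.

(** If neither direction from [p] meets a corner or runs forever, both stop, and the two runs joined
    at [p] form a corner-free path that cannot be prolonged. *)
Lemma block_cover p : placed p -> boundary B p ->
  exists2 t, building_block t & p \in t.
Proof.
move=> pp bp; have [f [d [fd f0 _]]] := walk_exists P true bp.
have rd := walk_reverse fd.
have r0 : f (- 0) = p by rewrite oppr0.
apply: contrapT => none.
have nc g d' (m : nat) : walk B P g d' -> g 0 = p -> run g m -> noncorner (g m%:Z).
  move=> gd g0 rg; apply: contrapT => c; apply: none.
  by rewrite -g0; exact: corner_block gd rg c.
have stop g d' : walk B P g d' -> g 0 = p -> exists m : nat,
    run g m /\ (g (m%:Z + 1) = g m%:Z \/ ~ placed (g (m%:Z + 1))).
  move=> gd g0; apply: run_stop; first by rewrite g0.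
  move=> rg; apply: none; rewrite -g0; apply: (cycle_block gd rg) => m.
  exact: nc gd g0 (rg m).
have [N [rN sN]] := stop _ _ fd f0.
have [M [rM sM]] := stop _ _ rd r0.
(* The shift by [M] puts the backward end of the joined path at index 0 and [p] at index [M]. *)
apply: (@corner_free_path_false _ _ _ _ _ hz rigid _ _ (M + N)
  (walk_shift fd (- M%:Z))).
- move=> i iMN; have [iM|iM] := leqP M i.
    have -> : i%:Z - M%:Z = (i - M)%N%:Z by lia.
    split; first by apply: rN.1; lia.
    apply: (nc _ _ _ fd f0); case: rN => h1 h2.
    by split=> j jm; [apply: h1 | apply: h2]; lia.
  have -> : i%:Z - M%:Z = - (M - i)%N%:Z by lia.
  split; first by apply: rM.1; lia.
  apply: (nc _ _ (M - i)%N rd r0); case: rM => h1 h2.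
  by split=> j jm; [apply: h1 | apply: h2]; lia.
- move=> i iMN; have [iM|iM] := leqP M i.
    have -> : i%:Z + 1 - M%:Z = (i - M)%N%:Z + 1 by lia.
    have -> : i%:Z - M%:Z = (i - M)%N%:Z by lia.
    by apply: rN.2; lia.
  have -> : i%:Z + 1 - M%:Z = - (M - i.+1)%N%:Z by lia.
  have -> : i%:Z - M%:Z = - ((M - i.+1)%N%:Z + 1) by lia.
  by apply: nesym; apply: rM.2; lia.
- have -> : (M + N)%N%:Z + 1 - M%:Z = N%:Z + 1 by lia.
  by have -> : (M + N)%N%:Z - M%:Z = N%:Z by lia.
- have -> : - 1 - M%:Z = - (M%:Z + 1) by lia.
  by have -> : 0 - M%:Z = - M%:Z by lia.
Qed.

Lemma vertex_blocks : exists T : set (seq 'rV[R]_2),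
    [/\ forall t, T t -> corner_trajectory B P t \/ rigid_cycle B P t,
        [set row i z | i in [set: 'I_q]] `&` boundary B = \bigcup_(t in T) [set` t] &
        forall c, ([set row i z | i in [set: 'I_q]] `&` inside B) c ->
          exists a b ua ub,
            [/\ T a, T b, augmentation B P a ua, augmentation B P b ub &
                crossing_point B ua ub c]].
Proof.
exists building_block; split.
- by move=> t [].
- apply/seteqP; split=> [x [[i _ <-] bx]|x [t [_ tS _] /tS[[i <-] bx]]].
    have pi : placed (row i z) by exists i.
    by have [t bt xt] := block_cover pi bx; exists t.
  by split=> //; exists i.
move=> c [[i _ ei] Ic]; have pc : placed c by exists i.
(* For each move type, the line through [c] carries a placed boundary point, whose block has an
   augmentation containing the full chord through [c]. *)
have key r : exists t u (k : nat), [/\ building_block t, augmentation B P t u,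
    (k.+1 < size u)%N, segment u`_k u`_k.+1 c &
    [/\ boundary B u`_k, mu r u`_k = mu r c & mu r u`_k.+1 = mu r c]].
  have [y [py by_ ey]] := placed_on_line hz rigid r Ic pc.
  have cry : crosses B P r y by exists c.
  have [bs es ns] := antipode_crosses by_ cry.
  have [t bt yt] := block_cover py by_.
  have [_ _ /(_ _ r yt cry)[u [k [au ku uk]]]] := bt.
  have seg := chord_segment by_ bs (nesym ns) (esym es) Ic (esym ey).
  exists t, u, k; split=> //; case: uk => -[-> ->] //.
  - by rewrite segmentC.
  - by split=> //; rewrite es.
  - by split=> //; rewrite es.
have [t [u [k [bt au ku sc [b1 e1 _]]]]] := key false.
have [t' [u' [k' [bt' au' ku' sc' [_ e1' e2']]]]] := key true.
(* If the two segments coincided, their end would have both move coordinates of [c], so the interior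
   point [c] would be on the boundary. *)
exists t, t', u, u'; split=> //; split=> //; exists k, k'; split=> // e.
have : segment u'`_k' u'`_k'.+1 u`_k by rewrite -e; exact: segment_left.
move=> /segment_dot/(_ e1' e2') e3.
by apply: (boundary_inside b1); rewrite (move_coord_inj2 e1 e3).
Qed.

End Covering.

(** * Points that no infinitesimal motion can move *)

Section Fixing.
Variables (R : realType) (B : board R) (P : two_move_rider) (q : nat).
Variables z v : 'M[R]_(q, 2).
Hypothesis tv : tangent B P z v.
Implicit Types (x y c : 'rV[R]_2) (r : bool) (t u : seq 'rV[R]_2).

Local Notation mu := (@move_coord R P).
Local Notation placed := (placed z).

Definition still x := forall i, row i z = x -> row i v = 0.

(** Pieces at the same place attack each other along both moves, so they have the same velocity. *)
Lemma still_of_one i : row i v = 0 -> still (row i z).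
Proof.
have [att _] := (tangentP B P z v).1 tv.
move=> i0 j ej; rewrite -i0; apply: (@move_coord_inj _ P) => r; apply: att.
by rewrite ej.
Qed.

Lemma corner_still k : still (@corner R B k).
Proof.
have [_ fixd] := (tangentP B P z v).1 tv.
by move=> i ei; apply: (@corner_fixed _ B k) => j ej; apply: fixd; rewrite ei.
Qed.

(** At a noncorner [y] the velocity is along the side, and the attack from [x] keeps it on the
    chord; the chord crosses the interior, so it is not parallel to the side. *)
Lemma chord_still r x y : chord B P r x y -> placed x -> still x -> still y.
Proof.
have [att fixd] := (tangentP B P z v).1 tv.
move=> ch [j ej] sx i ei; have [bx by_ _ e cx] := ch.
have [[k ek]|nc] := pselect (exists k, y = @corner R B k).
  by apply: (corner_still (k := k)); rewrite ei.
have ncy : @noncorner R B y by move=> k; apply/eqP => ek; apply: nc; exists k.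
have /boundaryP[_ [k ek]] := by_.
have [t et] := side_kernel (fixd k i (etrans (congr1 _ ei) ek)).
have : mu r (row i v) = 0.
  rewrite (att r i j); last by rewrite ei ej.
  by rewrite (sx j ej); exact: dot0l.
have cy : crosses B P r y by apply: crosses_coord cx.
have /(noncorner_crosses P r by_ ncy ek) nz := cy.
rewrite et move_coordZ => /eqP; rewrite mulf_eq0 (negbTE nz) orbF => /eqP ->.
by rewrite scale0r.
Qed.

Lemma corner_trajectory_still t : (forall x, x \in t -> placed x) ->
  corner_trajectory B P t -> forall x, x \in t -> still x.
Proof.
move=> tS [[I [b [m [[alt _] t0 tI tE _]]]] [k kt]].
have tP x : x \in t <-> exists2 i : nat, (i < size t)%N & x = b (m + i%:Z).
  rewrite {1}tE; split=> [/mapP[i]|[i it ->]].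
    by rewrite mem_iota => it ->; exists i.
  by apply/mapP; exists i; rewrite ?mem_iota.
have ch (i : nat) : (i.+1 < size t)%N ->
    exists r, chord B P r (b (m + i%:Z)) (b (m + i.+1%:Z)).
  move=> it; rewrite PoszS addrA; apply: alternating_chord alt _ _.
    by apply: tI; exact: ltnW.
  by rewrite -addrA -PoszS; exact: tI.
have pl (i : nat) : (i < size t)%N -> placed (b (m + i%:Z)).
  by move=> it; apply: tS; apply/tP; exists i.
have /tP[i0 it0 ei0] := kt.
have s0 : still (b (m + i0%:Z)) by rewrite -ei0; exact: corner_still.
have up (l : nat) : (i0 + l < size t)%N -> still (b (m + (i0 + l)%N%:Z)).
  elim: l => [|l IH] lt; first by rewrite addn0.
  rewrite addnS in lt *; have [r cr] := ch _ lt.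
  exact: chord_still cr (pl _ (ltnW lt)) (IH (ltnW lt)).
have down (l : nat) : (l <= i0)%N -> still (b (m + (i0 - l)%N%:Z)).
  elim: l => [|l IH] lt; first by rewrite subn0.
  have e : (i0 - l)%N = (i0 - l.+1).+1 by lia.
  have [|r cr] := ch (i0 - l.+1)%N; first lia.
  rewrite -e in cr; apply: chord_still (chordC cr) _ (IH (ltnW lt)).
  by apply: pl; lia.
move=> x /tP[i it ->]; have [ii|ii] := leqP i0 i.
  by rewrite -(subnKC ii); apply: up; rewrite subnKC.
have -> : i = (i0 - (i0 - i))%N by lia.
by apply: down; lia.
Qed.

(** Choosing one piece at each point of the cycle restricts [v] to a motion of the cycle, which is
    zero by full rank. *)
Lemma rigid_cycle_still t : (forall x, x \in t -> placed x) ->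
  rigid_cycle B P t -> forall x, x \in t -> still x.
Proof.
have [att fixd] := (tangentP B P z v).1 tv.
move=> tS [_ /full_rankP fr].
have [s sP] : exists s : 'I_(size t) -> 'I_q, forall i, row (s i) z = t`_i.
  have [s sP] := choice (fun i : 'I_(size t) => tS _ (mem_nth 0 (ltn_ord i))).
  by exists s.
have : \matrix_i row (s i) v = 0 :> 'M[R]_(size t, 2).
  apply: fr; apply/tangentP; split=> [r i j|k i]; rewrite !rowK => e.
    by apply: att; rewrite !sP.
  by apply: fixd; rewrite sP.
move=> v0 x xt; have ix : (index x t < size t)%N by rewrite index_mem.
have <- : row (s (Ordinal ix)) z = x by rewrite sP /= nth_index.
by apply: still_of_one; move/row_matrixP/(_ (Ordinal ix)): v0; rewrite rowK row0.
Qed.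

(** Distinct chords through [c] have different types, since on one line there is only one chord.
    Each carries a still point, so both move coordinates of the velocity at [c] vanish. *)
Lemma crossing_still t t' u u' c :
  (forall x, x \in t -> placed x /\ still x) ->
  (forall x, x \in t' -> placed x /\ still x) ->
  augmentation B P t u -> augmentation B P t' u' -> crossing_point B u u' c ->
  still c.
Proof.
have [att fixd] := (tangentP B P z v).1 tv.
move=> ts ts' au au' [Ic [k [k' [ku ku' sc sc' ne]]]].
have [r ch [x xt ex]] := augmentation_edge au ku.
have [r' ch' [x' xt' ex']] := augmentation_edge au' ku'.
have [b1 b2 n12 e12 cr] := ch; have [b1' b2' n12' e12' cr'] := ch'.
have ec : mu r c = mu r u`_k := segment_dot sc erefl (esym e12).
have ec' : mu r' c = mu r' u'`_k' := segment_dot sc' erefl (esym e12').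
have rr' : r' = ~~ r.
  apply/eqP; rewrite -[_ == _]negbK; apply/negP => h; apply: ne.
  have {h} h : r' = r by case: (r) (r') h => -[].
  rewrite h in ch' ec' b1' e12'.
  have e' : mu r u'`_k' = mu r u`_k by rewrite -ec' ec.
  have [e1|n1] := pselect (u'`_k' = u`_k).
    by rewrite e1 in ch' *; rewrite (chord_antipode ch) (chord_antipode ch').
  have e2 : u'`_k' = u`_k.+1.
    by rewrite (chord_antipode ch); apply: antipode_unique.
  rewrite segmentC e2; rewrite e2 in ch'.
  by rewrite (chord_antipode (chordC ch)) (chord_antipode ch').
have [[j ej] sx] := ts _ xt; have [[j' ej'] sx'] := ts' _ xt'.
move=> i ei; apply: (@move_coord_inj2 _ P r).
  rewrite (att r i j); first by rewrite (sx _ ej).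
  by rewrite ei ej ec ex.
rewrite -rr' (att r' i j'); first by rewrite (sx' _ ej').
by rewrite ei ej' ec' ex'.
Qed.

End Fixing.

Theorem theorem5p10 (R : realType) (B : board R) (P : two_move_rider) (q : nat)
    (z : 'M[R]_(q, 2)) (hz : forall i : 'I_q, region B (row i z)) :
  let S : set 'rV[R]_2 := [set row i z | i in [set: 'I_q]] in
  let Sbd := S `&` boundary B in
  let Sint := S `&` inside B in
  is_vertex B P z <->
  exists T : set (seq 'rV[R]_2),
    [/\ forall t, T t -> corner_trajectory B P t \/ rigid_cycle B P t,
        Sbd = \bigcup_(t in T) [set` t] &
        forall c, Sint c ->
          exists a b ua ub,
            [/\ T a, T b, augmentation B P a ua, augmentation B P b ub &
                crossing_point B ua ub c]].
Proof.
move=> S Sbd Sint; rewrite (vertexP P hz); split; first exact: vertex_blocks.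
move=> [T [Tct TS Tc]] v tv.
have tS t x : T t -> x \in t -> placed z x.
  move=> Tt xt; have [[i _ <-] _] : Sbd x by rewrite TS; exists t.
  by exists i.
have tst t x : T t -> x \in t -> still z v x.
  move=> Tt.
  by case: (Tct _ Tt) => [/(corner_trajectory_still tv)|/(rigid_cycle_still tv)];
    apply=> y; exact: tS.
apply/row_matrixP => i; rewrite row0.
have Si : S (row i z) by exists i.
case: (region_inside_or_boundary (hz i)) => [Ii|bi].
  have [a [b [ua [ub [Ta Tb aa ab cr]]]]] := Tc (row i z) (conj Si Ii).
  apply: (crossing_still tv _ _ aa ab cr) => // x xt.
    by split; [exact: tS xt | exact: tst xt].
  by split; [exact: tS xt | exact: tst xt].
have : Sbd (row i z) by [].
by rewrite TS => -[t Tt /= xt]; exact: (tst _ _ Tt xt).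
Qed.
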